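(* Let $R$ be a noetherian commutative ring with identity and let $f,g:\mathbb{P}^N_R\to\mathbb{P}^N_R$ be two morphisms of degree $d\ge 2$. Then the functor $\mathrm{Conj}_{f,g}$ is represented by a closed finite $R$-subscheme $\mathrm{Conj}_{f,g}\subset\mathrm{PGL}_{N+1}$.
   Context: A morphism $\mathbb{P}^N_R\to\mathbb{P}^N_R$ of degree $d$ is given by homogeneous polynomials of degree $d$ in $R[x_0,\dots,x_N]$ whose Macaulay resultant is a unit in $R$. For an $R$-algebra $S$ and $\alpha\in\mathrm{PGL}_{N+1}(S)$ (identified with the automorphisms of $\mathbb{P}^N_S$), $f^\alpha=\alpha\circ f\circ\alpha^{-1}$. The functor $\mathrm{Conj}_{f,g}$ from commutative $R$-algebras to sets is $S\mapsto\{\alpha\in\mathrm{PGL}_{N+1}(S): f^\alpha=g\}$, acting on $R$-algebra morphisms by base extension. *)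

(* Defs.v *)
(* Conventions.
   - Rings are [comPzRingType]s, so the zero ring is allowed throughout.  An
     R-algebra is a commutative ring S with a structure morphism
     [psi : {rmorphism R -> S}].
   - R-schemes and their morphisms are described by their functors of points on
     commutative R-algebras; by Yoneda, two morphisms are equal iff they agree
     on T-points for all T. *)

From HB Require Import structures.
From mathcomp Require Import all_boot all_order all_algebra.
From mathcomp Require Import mpoly.

Set Implicit Arguments.
Unset Strict Implicit.
Unset Printing Implicit Defensive.

Import GRing.Theory.
Local Open Scope ring_scope.

Definition is_ideal (R : comPzRingType) (I : R -> Prop) : Prop :=
  [/\ I 0,
      forall x y, I x -> I y -> I (x + y)
    & forall a x, I x -> I (a * x)].

Definition noetherian (R : comPzRingType) : Prop :=
  forall I : R -> Prop, is_ideal I ->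
    exists k (a : 'I_k -> R),
      forall x, I x <-> exists c : 'I_k -> R, x = \sum_i c i * a i.

Definition is_unit (R : comPzRingType) (x : R) : Prop := exists y, y * x = 1.

Definition module_finite (R B : comPzRingType) (iota : {rmorphism R -> B}) :=
  exists k (b : 'I_k -> B),
    forall x, exists c : 'I_k -> R, x = \sum_i iota (c i) * b i.

Section Submodules.
Variables (S : comPzRingType) (a b : nat).

Definition span (A : 'M[S]_(a, b) -> Prop) (X : 'M[S]_(a, b)) : Prop :=
  exists k (c : 'I_k -> S) (Y : 'I_k -> 'M[S]_(a, b)),
    (forall i, A (Y i)) /\ X = \sum_i c i *: Y i.

Definition same_sub (A B : 'M[S]_(a, b) -> Prop) : Prop :=
  forall X, A X <-> B X.

(* L is a direct summand (the image of an idempotent endomorphism P of the free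
   module 'M_(a, b)) whose rank, i.e. the dimension of its fibre at each
   field-valued point of Spec S, is 1. *)
Definition rank1_summand (L : 'M[S]_(a, b) -> Prop) : Prop :=
  exists P : 'M[S]_(a * b),
    [/\ P *m P = P,
        forall X, L X <-> mxvec X *m P = mxvec X
      & forall (K : fieldType) (h : {rmorphism S -> K}),
          \rank (map_mx h P) = 1%N].

End Submodules.

Definition base_change (S T : comPzRingType) (h : {rmorphism S -> T}) (a b : nat)
    (L : 'M[S]_(a, b) -> Prop) : 'M[T]_(a, b) -> Prop :=
  span (fun Y => exists2 X, L X & Y = map_mx h X).

Definition dmon (N d : nat) := {m : 'X_{1..N.+1 < d.+1} | mdeg m == d}.

Definition dmon_exp (N d : nat) (m : dmon N d) (i : 'I_N.+1) : nat :=
  (val m : 'X_{1..N.+1}) i.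

(* N + 1 forms of degree d in N + 1 variables, given by their coefficients
   ({mpoly R[_]} would exclude the zero ring). *)
Definition forms (R : Type) (N d : nat) := 'I_N.+1 -> dmon N d -> R.

Definition map_forms (R S : Type) (h : R -> S) (N d : nat) (F : forms R N d) :
  forms S N d := fun i m => h (F i m).

Definition eval_forms (R : comPzRingType) (N d : nat) (F : forms R N d)
    (v : 'cV[R]_N.+1) : 'cV[R]_N.+1 :=
  \col_i \sum_(m : dmon N d) F i m * \prod_j v j 0 ^+ dmon_exp m j.

Definition power_forms (R : comPzRingType) (N d : nat) : forms R N d :=
  fun i m => (dmon_exp m i == d)%:R.

Definition ncoef (N d : nat) : nat := #|{: 'I_N.+1 * dmon N d}|.

Notation coefring N d := {mpoly int[ncoef N d]}.

Definition generic_forms (N d : nat) : forms (coefring N d) N d :=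
  fun i m => 'X_(enum_rank (i, m)).

(* The i-th generic form as an element of Z[u][x_0, ..., x_N]. *)
Definition generic_poly (N d : nat) (i : 'I_N.+1) :
    {mpoly (coefring N d)[N.+1]} :=
  eval_forms (map_forms (@mpolyC N.+1 (coefring N d)) (@generic_forms N d))
    (\col_j 'X_j) i 0.

(* The elimination ideal of the generic forms (inertia forms of degree 0): the
   p in Z[u] such that p * (x_0, ..., x_N)^k lies in the ideal of
   Z[u][x_0, ..., x_N] generated by the generic forms, for k large. *)
Definition elimination_ideal (N d : nat) (p : coefring N d) : Prop :=
  exists k : nat, forall j : 'I_N.+1,
    exists Q : 'I_N.+1 -> {mpoly (coefring N d)[N.+1]},
      p%:MP * 'X_j ^+ k = \sum_i Q i * generic_poly d i.

Definition eval_coefs (R : comPzRingType) (N d : nat) (r : coefring N d)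
    (F : forms R N d) : R :=
  \sum_(m <- msupp r) (r@_m)%:~R *
    \prod_(l < ncoef N d) F (enum_val l).1 (enum_val l).2 ^+ m l.

(* The Macaulay resultant of N + 1 forms of degree d is the generator of the
   (principal) elimination ideal, the sign being fixed by
   Res(x_0^d, ..., x_N^d) = 1. *)
Definition is_macaulay_resultant (N d : nat) (r : coefring N d) : Prop :=
  (forall p, elimination_ideal p <-> exists q, p = q * r) /\
  eval_coefs r (@power_forms int N d) = 1.

Definition unit_resultant (R : comPzRingType) (N d : nat) (F : forms R N d) :=
  exists r : coefring N d,
    is_macaulay_resultant r /\ is_unit (eval_coefs r F).

Definition PN_point (N : nat) (T : comPzRingType) (L : 'cV[T]_N.+1 -> Prop) :=
  rank1_summand L.

(* The endomorphism [x] |-> [F_0(x) : ... : F_N(x)] on T-points.  Where L is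
   free on v, the span of all F(sv) = s^d F(v) is free on F(v). *)
Definition endo (T : comPzRingType) (N d : nat) (F : forms T N d)
    (L : 'cV[T]_N.+1 -> Prop) : 'cV[T]_N.+1 -> Prop :=
  span (fun w => exists2 v, L v & w = eval_forms F v).

(* PGL_{N+1} is the open subscheme det != 0 of the projective space of
   (N+1) x (N+1) matrices.  An S-point is thus a rank one direct summand of
   'M_(N+1)(S), Zariski locally generated by an invertible matrix; it need not
   come from a single matrix over S. *)
Definition PGL_point (N : nat) (S : comPzRingType) (al : 'M[S]_N.+1 -> Prop) :=
  rank1_summand al /\
  forall (K : fieldType) (h : {rmorphism S -> K}),
    exists2 M, al M & map_mx h M \in unitmx.

Definition PGL_act (N : nat) (T : comPzRingType) (al : 'M[T]_N.+1 -> Prop)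
    (L : 'cV[T]_N.+1 -> Prop) : 'cV[T]_N.+1 -> Prop :=
  span (fun w => exists M v, [/\ al M, L v & w = M *m v]).

(* The adjugate of an invertible matrix represents its inverse in PGL. *)
Definition PGL_inv (N : nat) (T : comPzRingType) (al : 'M[T]_N.+1 -> Prop) :
    'M[T]_N.+1 -> Prop :=
  span (fun X => exists2 M, al M & X = \adj M).

Definition conj_endo (N d : nat) (T : comPzRingType) (al : 'M[T]_N.+1 -> Prop)
    (F : forms T N d) (L : 'cV[T]_N.+1 -> Prop) : 'cV[T]_N.+1 -> Prop :=
  PGL_act al (endo F (PGL_act (PGL_inv al) L)).

(* f^al = g as endomorphisms of P^N_S. *)
Definition conjugates (N d : nat) (R S : comPzRingType)
    (psi : {rmorphism R -> S}) (F G : forms R N d) (al : 'M[S]_N.+1 -> Prop) :=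
  forall (T : comPzRingType) (k : {rmorphism S -> T})
         (L : 'cV[T]_N.+1 -> Prop), PN_point L ->
    same_sub (conj_endo (base_change k al) (map_forms (k \o psi) F) L)
             (endo (map_forms (k \o psi) G) L).

Definition Conj (N d : nat) (R S : comPzRingType) (psi : {rmorphism R -> S})
    (F G : forms R N d) (al : 'M[S]_N.+1 -> Prop) : Prop :=
  PGL_point al /\ conjugates psi F G al.

(* For u in PGL_{N+1}(B): h is an R-algebra morphism B -> S, i.e. an S-point of
   Spec B, whose image under u : Spec B -> PGL_{N+1} is al. *)
Definition point_over (N : nat) (R B S : comPzRingType)
    (iota : {rmorphism R -> B}) (u : 'M[B]_N.+1 -> Prop)
    (psi : {rmorphism R -> S}) (al : 'M[S]_N.+1 -> Prop)
    (h : {rmorphism B -> S}) : Prop :=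
  (forall x, h (iota x) = psi x) /\ same_sub (base_change h u) al.

(* The R-morphism u : Spec B -> PGL_{N+1} is a closed immersion: for each
   al : Spec S -> PGL_{N+1} over R, the fibre product of u and al is
   Spec (S / J) for an ideal J of S. *)
Definition closed_immersion (N : nat) (R B : comPzRingType)
    (iota : {rmorphism R -> B}) (u : 'M[B]_N.+1 -> Prop) : Prop :=
  PGL_point u /\
  forall (S : comPzRingType) (psi : {rmorphism R -> S})
         (al : 'M[S]_N.+1 -> Prop), PGL_point al ->
    exists2 J : S -> Prop, is_ideal J &
      forall (T : comPzRingType) (k : {rmorphism S -> T}),
        (forall x, J x -> k x = 0) <->
        exists h : {rmorphism B -> T},
          point_over iota u (k \o psi) (base_change k al) h /\
          forall h' : {rmorphism B -> T},
            point_over iota u (k \o psi) (base_change k al) h' -> h =1 h'.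

(* h |-> h_* u is a (necessarily natural) bijection from Hom_R(B, S) onto
   Conj_{f,g}(S) for every R-algebra S. *)
Definition represents_Conj (N d : nat) (R B : comPzRingType)
    (iota : {rmorphism R -> B}) (u : 'M[B]_N.+1 -> Prop)
    (F G : forms R N d) : Prop :=
  forall (S : comPzRingType) (psi : {rmorphism R -> S}),
    [/\ forall h : {rmorphism B -> S}, (forall x, h (iota x) = psi x) ->
          Conj psi F G (base_change h u),
        forall h h' : {rmorphism B -> S},
          (forall x, h (iota x) = psi x) -> (forall x, h' (iota x) = psi x) ->
          same_sub (base_change h u) (base_change h' u) -> h =1 h'
      & forall al : 'M[S]_N.+1 -> Prop, Conj psi F G al ->
          exists h : {rmorphism B -> S}, point_over iota u psi al h].

(* Main.v *)
(* An S-point of PGL_{N+1}, locally the class of an invertible matrix A, is the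
   same as a tensor p = A (x) A^-1 over S: p is invariant under scaling of A, and
   such tensors are cut out by the Segre relations and by A A^-1 = A^-1 A = 1.
   Conjugation, A F(A^-1 x) = c G(x) with c a unit, becomes a system of equations
   in p once c is eliminated, so Conj_{f,g} is a closed subscheme of PGL_{N+1}.
   It is finite because every entry f = a_ij b_kl of p, with B = A^-1, is
   integral: if e_j and e_l are the basis vectors, then
     G(A e_j) = c^-1 A F(e_j) and F(B e_l) = c B G(e_l)
   are linear in A and in B up to factors that cancel each other, while a power
   of a_ij is a combination of the G_s(A e_j), and a power of b_kl one of the
   F_t(B e_l), because the resultants are units. As d >= 2, this rewrites a power
   of f as a polynomial of smaller degree in the entries of p, with coefficients
   in R. *)

Require Import Defs.
From HB Require Import structures.
From mathcomp Require Import all_boot all_order all_algebra.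
From mathcomp Require Import mpoly.
From mathcomp Require Import ring zify.
From mathcomp Require boolp classical_sets.

Set Implicit Arguments.
Unset Strict Implicit.
Unset Printing Implicit Defensive.

Import Defs GRing.Theory.
Local Open Scope ring_scope.

(** * Quotients and field-valued points *)

(** Since A exists only locally, the proof works with the pivots [p ord0 j j ord0] = a_0j b_j0,
    whose sum is 1. Where the pivot f of index j is invertible, the slices b_j0 A and a_0j A^-1 of p
    are matrices over the base that represent A and A^-1 and have product f. Statements are proved
    up to a power of each pivot and then glued; this is where the many exponents come from. The
    factor p_ijkl^(d-1) in [conj_eqs] balances degrees: in each of the slices b_kl A and a_ij A^-1
    the left side has degree d, the right side degree 1. The harder implication extracts polynomial
    identities from equalities of submodules at T-points, which determine A F(A^-1 x) only up to a
    factor that may vary with the point. At the generic point, with x_0 inverted, the factor lies a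
    priori in S[x][1/x_0]; the unit resultant of G forces it to be a constant of S. Rank and
    invertibility are given at field-valued points only, and are lifted to S by showing that
    suitable ideals contain 1. *)

Lemma same_subE (S : comPzRingType) (a b : nat) (A B : 'M[S]_(a, b) -> Prop) :
  same_sub A B -> A = B.
Proof. by move=> AB; apply: boolp.funext => X; apply: boolp.propext. Qed.

Section Quotient.
Variables (A : comPzRingType) (I : A -> Prop) (idI : is_ideal I).

Let I0 : I 0. Proof. by case: idI. Qed.
Let ID x y : I x -> I y -> I (x + y). Proof. by case: idI => _ + _; apply. Qed.
Let IM a x : I x -> I (a * x). Proof. by case: idI => _ _; apply. Qed.
Let IN x : I x -> I (- x). Proof. by rewrite -mulN1r; apply: IM. Qed.

(** The choice made in a coset depends on the coset only, so the quotient can be taken to be the set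
    of fixed points. Membership in [I] is made boolean classically. *)
Definition coset_repr (x : A) : A := choose (fun y => boolp.asbool (I (y - x))) x.

Let reprP x : I (coset_repr x - x).
Proof.
apply/boolp.asboolP; rewrite /coset_repr.
apply: (@chooseP A (fun y => boolp.asbool (I (y - x)))).
by apply/boolp.asboolP; rewrite subrr.
Qed.

Let eq_repr x y : I (x - y) -> coset_repr x = coset_repr y.
Proof.
move=> Ixy; rewrite /coset_repr.
rewrite (@eq_choose A _ (fun z => boolp.asbool (I (z - y)))) => [|z].
  apply: choose_id; apply/boolp.asboolP => //.
  by rewrite subrr.
apply/boolp.asboolP/boolp.asboolP => Iz.
  by rewrite -(subrKA x); apply: ID.
by rewrite -(subrKA y) -[y - x]opprB; apply: ID => //; apply: IN.
Qed.

Let repr_idem x : coset_repr (coset_repr x) == coset_repr x.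
Proof. by apply/eqP/eq_repr/reprP. Qed.

Definition quot := {x : A | coset_repr x == x}.
HB.instance Definition _ := Choice.on quot.

Definition quot_pi (x : A) : quot := exist _ (coset_repr x) (repr_idem x).
Local Notation pi := quot_pi.

Lemma quot_piP x y : pi x = pi y <-> I (x - y).
Proof.
split=> [[e]|/eq_repr e]; last by apply: val_inj.
rewrite -(subrKA (coset_repr x)); apply: ID; last by rewrite {1}e; apply: reprP.
by rewrite -opprB; apply: IN; apply: reprP.
Qed.

Let pi_val (x : quot) : pi (val x) = x.
Proof. by apply: val_inj; apply/eqP; case: x. Qed.

Let add (x y : quot) := pi (val x + val y).
Let opp (x : quot) := pi (- val x).
Let mul (x y : quot) := pi (val x * val y).

Let piD x y : add (pi x) (pi y) = pi (x + y).
Proof.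
by apply/quot_piP; rewrite opprD addrACA; apply: ID; apply: reprP.
Qed.
Let piN x : opp (pi x) = pi (- x).
Proof. by apply/quot_piP; rewrite -opprD; apply: IN; apply: reprP. Qed.
Let piM x y : mul (pi x) (pi y) = pi (x * y).
Proof.
apply/quot_piP => /=.
rewrite -(subrKA (x * coset_repr y)); apply: ID.
  by rewrite -mulrBl mulrC; apply/IM/reprP.
by rewrite -mulrBr; apply/IM/reprP.
Qed.

Let ind (P : quot -> Prop) : (forall x, P (pi x)) -> forall x, P x.
Proof. by move=> Ppi x; rewrite -(pi_val x). Qed.

Let addA : associative add.
Proof. by do 3!elim/ind => ?; rewrite !piD addrA. Qed.
Let addC : commutative add.
Proof. by do 2!elim/ind => ?; rewrite !piD addrC. Qed.
Let add0 : left_id (pi 0) add.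
Proof. by elim/ind => ?; rewrite !piD add0r. Qed.
Let addN : left_inverse (pi 0) opp add.
Proof. by elim/ind => ?; rewrite piN piD addNr. Qed.
HB.instance Definition _ := GRing.isZmodule.Build quot addA addC add0 addN.

Let mulA : associative mul.
Proof. by do 3!elim/ind => ?; rewrite !piM mulrA. Qed.
Let mulC : commutative mul.
Proof. by do 2!elim/ind => ?; rewrite !piM mulrC. Qed.
Let mul1 : left_id (pi 1) mul.
Proof. by elim/ind => ?; rewrite !piM mul1r. Qed.
Let mulD : left_distributive mul add.
Proof. by do 3!elim/ind => ?; rewrite ?(piD, piM) mulrDl. Qed.
HB.instance Definition _ := GRing.Zmodule_isComPzRing.Build quot mulA mulC mul1 mulD.

Let pi_zmod : zmod_morphism pi.
Proof. by move=> x y; rewrite -[X in X = _]piD -[pi (- y)]piN. Qed.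
HB.instance Definition _ := GRing.isZmodMorphism.Build A quot pi pi_zmod.

Let pi_mon : monoid_morphism pi.
Proof. by split=> // x y; rewrite [RHS]/(mul _ _) piM. Qed.
HB.instance Definition _ := GRing.isMonoidMorphism.Build A quot pi pi_mon.

Lemma quotient_ring :
  exists (B : comPzRingType) (f : {rmorphism A -> B}),
    (forall y, exists x, f x = y) /\ (forall x, f x = 0 <-> I x).
Proof.
exists quot, pi; split=> [y|x]; first by exists (val y); apply: pi_val.
by rewrite -(rmorph0 pi) quot_piP subr0.
Qed.

End Quotient.

Lemma ker_ideal (A B : comPzRingType) (f : {rmorphism A -> B}) :
  is_ideal (fun x => f x = 0).
Proof.
split=> [|x y fx fy|a x fx]; first exact: rmorph0.
  by rewrite rmorphD fx fy addr0.
by rewrite rmorphM fx mulr0.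
Qed.

Lemma rmorphism_factor (A B S : comPzRingType) (f : {rmorphism A -> B})
    (g : {rmorphism A -> S}) :
  (forall y, exists x, f x = y) -> (forall x, f x = 0 -> g x = 0) ->
  exists h : {rmorphism B -> S}, forall x, h (f x) = g x.
Proof.
move=> fsurj fg; pose s y := projT1 (boolp.cid (fsurj y)).
have sK y : f (s y) = y by rewrite /s; case: boolp.cid.
have gE x y : f x = f y -> g x = g y.
  move=> e; apply/eqP; rewrite -subr_eq0 -rmorphB; apply/eqP/fg.
  by rewrite rmorphB e subrr.
pose h y := g (s y).
have hzmod : zmod_morphism h.
  by move=> x y; rewrite /h -rmorphB; apply: gE; rewrite rmorphB !sK.
have hmon : monoid_morphism h.
  split=> [|x y]; first by rewrite /h -(rmorph1 g); apply: gE; rewrite sK rmorph1.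
  by rewrite /h -rmorphM; apply: gE; rewrite rmorphM !sK.
pose hZ := GRing.isZmodMorphism.Build B S h hzmod.
pose hM := GRing.isMonoidMorphism.Build B S h hmon.
pose H : {rmorphism B -> S} := HB.pack h hZ hM.
by exists H => x; apply: gE; rewrite sK.
Qed.

(** Polynomials are formed over nonzero rings, so the zero ring is split off whenever polynomials
    over [S] occur. *)
Lemma nonzero_ring_ind (P : comPzRingType -> Prop) :
  (forall S : comPzRingType, (1 : S) = 0 -> P S) ->
  (forall S : comNzRingType, P S) -> forall S, P S.
Proof.
move=> P0 P1 S; case: (eqVneq (1 : S) 0) => [/P0//|nz1].
pose m := GRing.PzSemiRing_isNonZero.Build S nz1.
pose S' : comNzRingType := HB.pack (GRing.ComPzRing.sort S) m.
suff <- : (S' : comPzRingType) = S by apply: P1.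
by rewrite /S'; case: S nz1 m @S' => T [].
Qed.

Lemma zero_ring (S : comPzRingType) : (1 : S) = 0 -> forall x y : S, x = y.
Proof. by move=> e x y; rewrite -[x]mul1r -[y]mul1r e !mul0r. Qed.

Lemma maximal_ideal (S : comPzRingType) (I : S -> Prop) :
  is_ideal I -> ~ I 1 ->
  exists2 M : S -> Prop, is_ideal M /\ (forall x, I x -> M x) &
    ~ M 1 /\ forall x, ~ M x -> exists y, M (1 - y * x).
Proof.
move=> idI I1.
pose P (M : S -> Prop) := [/\ is_ideal M, forall x, I x -> M x & ~ M 1].
pose T := {M : S -> Prop | P M}.
pose leT (M N : T) : bool := boolp.asbool (forall x, sval M x -> sval N x).
have leP M N : reflect (forall x, sval M x -> sval N x) (leT M N).
  exact: boolp.asboolP.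
have [||||M maxM] := @classical_sets.Zorn T leT.
- by move=> t; apply/leP.
- by move=> r s t /leP rs /leP st; apply/leP => x /rs /st.
- move=> [M PM] [N PN] /leP /= MN /leP /= NM; apply: boolp.eq_exist.
  by apply: boolp.funext => x; apply: boolp.propext; split; [apply: MN|apply: NM].
- move=> C totC; case: (boolp.pselect (exists M, C M)) => [[M0 CM0]|noC]; last first.
    (* The empty chain needs an upper bound too, and [I] is one. *)
    have PI : P I by [].
    by exists (exist _ I PI) => s Cs; case: noC; exists s.
  pose U x := exists2 M, C M & sval M x.
  have PU : P U.
    split=> [||[M CM]]; last 1 first.
    - by case: M CM => M [? ? ?].
    - split=> [|x y [M CM Mx] [N CN Ny]|a x [M CM Mx]].
      + by exists M0 => //; case: (svalP M0) => -[].
      + case: (totC _ _ CM CN) => /leP sub.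
        * exists N => //; case: (svalP N) => -[_ ND _] _ _; apply: ND => //.
          exact: sub.
        * exists M => //; case: (svalP M) => -[_ MD _] _ _; apply: MD => //.
          exact: sub.
      + by exists M => //; case: (svalP M) => -[_ _ MM] _ _; apply: MM.
    by move=> x Ix; exists M0 => //; case: (svalP M0) => _ + _; apply.
  by exists (exist _ U PU) => M CM; apply/leP => x Mx; exists M.
case: M maxM => M PM maxM; case: (PM) => idM IM M1; exists M => //; split=> // x nMx.
have [M0 MD MM] := idM.
(* [N] is the ideal M + (x). If [x] had no inverse modulo [M], then [N] would be proper, hence equal
   to [M], and [x] would lie in [M]. *)
pose N z := exists a, M (z - a * x).
apply: boolp.contrapT => nox.
have PN : P N.
  split=> [|z Iz|[a Ma]]; last by apply: nox; exists a.
    split=> [|z1 z2 [a1 M1'] [a2 M2]|c z [a Ma]].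
    - by exists 0; rewrite mul0r subr0.
    - by exists (a1 + a2); rewrite mulrDl opprD addrACA; apply: MD.
    - by exists (c * a); rewrite -mulrA -mulrBr; apply: MM.
  by exists 0; rewrite mul0r subr0; apply: IM.
have /maxM [NM] : leT (exist _ M PM) (exist _ N PN).
  by apply/leP => z /= Mz; exists 0; rewrite mul0r subr0.
by apply: nMx; rewrite -NM; exists 1; rewrite mul1r subrr.
Qed.

Lemma field_point (S : comPzRingType) (I : S -> Prop) :
  is_ideal I -> ~ I 1 ->
  exists (K : fieldType) (h : {rmorphism S -> K}), forall x, I x -> h x = 0.
Proof.
move=> idI I1; have [M [idM IM] [M1 maxM]] := maximal_ideal idI I1.
have [B [f [fsurj kerf]]] := quotient_ring idM.
suff [K [g _]] : exists (K : fieldType) (g : {rmorphism B -> K}), True.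
  by exists K, (g \o f) => x Ix /=; rewrite ((kerf x).2 _) ?rmorph0 //; apply: IM.
have nz1 : (1 : B) != 0.
  by apply/eqP => e; apply/M1/kerf; rewrite rmorph1.
have invB (x : B) : exists y, x <> 0 -> y * x = 1.
  case: (fsurj x) => a <-; case: (boolp.pselect (M a)) => [/kerf ->|/maxM[y My]].
    by exists 0.
  exists (f y) => _; apply/eqP; rewrite eq_sym -subr_eq0 -rmorphM -(rmorph1 f).
  by rewrite -rmorphB; apply/eqP/kerf.
pose m := GRing.PzSemiRing_isNonZero.Build B nz1.
pose B' : comNzRingType := HB.pack (GRing.ComPzRing.sort B) m.
pose inv (x : B') : B' := if x == 0 then 0 else projT1 (boolp.cid (invB x)).
have mulVx : forall x : B', x != 0 -> inv x * x = 1.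
  move=> x nzx; rewrite /inv (negPf nzx); case: boolp.cid => y /=.
  by apply; apply/eqP.
have inv0 : inv 0 = 0 by rewrite /inv eqxx.
pose fm := GRing.ComNzRing_isField.Build B' mulVx inv0.
pose K : fieldType := HB.pack (GRing.ComPzRing.sort B) m fm.
pose g (x : B) : K := x.
have gz : zmod_morphism g by [].
have gm : monoid_morphism g by [].
pose G : {rmorphism B -> K} := HB.pack g (GRing.isZmodMorphism.Build B K g gz)
   (GRing.isMonoidMorphism.Build B K g gm).
by exists K, G.
Qed.

(** Otherwise [I] would vanish in a residue field. This turns the conditions at field-valued points
    in [rank1_summand] and [PGL_point] into statements over [S]. *)
Lemma ideal_has1 (S : comPzRingType) (I : S -> Prop) : is_ideal I ->
  (forall (K : fieldType) (h : {rmorphism S -> K}), exists2 x, I x & h x != 0) ->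
  I 1.
Proof.
move=> idI Ih; apply: boolp.contrapT => /(field_point idI)[K [h hI]].
by have [x /hI ->] := Ih K h; rewrite eqxx.
Qed.

(** * Forms and elimination *)

Lemma map_eval_forms (S T : comPzRingType) (h : {rmorphism S -> T}) (N d : nat)
    (F : forms S N d) (v : 'cV[S]_N.+1) :
  map_mx h (eval_forms F v) = eval_forms (map_forms h F) (map_mx h v).
Proof.
apply/matrixP => i j; rewrite !mxE rmorph_sum; apply: eq_bigr => m _.
rewrite rmorphM rmorph_prod; congr (_ * _); apply: eq_bigr => l _.
by rewrite rmorphXn mxE.
Qed.

Lemma map_eval_formsE (S T : comPzRingType) (h : {rmorphism S -> T}) (N d : nat)
    (F : forms S N d) (v : 'cV[S]_N.+1) i :
  h (eval_forms F v i 0) = eval_forms (map_forms h F) (map_mx h v) i 0.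
Proof. by rewrite -map_eval_forms [RHS]mxE. Qed.

Lemma dmon_expE (N d : nat) (m : dmon N d) : (\sum_j dmon_exp m j)%N = d.
Proof. by rewrite -mdegE; apply/eqP; case: m. Qed.

Lemma eval_formsZ (S : comPzRingType) (N d : nat) (F : forms S N d) (a : S)
    (v : 'cV[S]_N.+1) : eval_forms F (a *: v) = a ^+ d *: eval_forms F v.
Proof.
apply/matrixP => i j; rewrite !mxE mulr_sumr; apply: eq_bigr => m _.
rewrite mulrCA; congr (_ * _).
under eq_bigr do rewrite mxE exprMn.
by rewrite big_split /= prodrXr dmon_expE.
Qed.

Lemma mpoly_hom_exists (R : comNzRingType) (m : nat) (S : comPzRingType)
    (psi : {rmorphism R -> S}) (x : 'I_m -> S) :
  exists phi : {rmorphism {mpoly R[m]} -> S},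
    (forall c, phi c%:MP = psi c) /\ (forall i, phi 'X_i = x i).
Proof.
elim/nonzero_ring_ind: S psi x => [S S0|S] psi x.
  have Seq := zero_ring S0.
  pose g (_ : {mpoly R[m]}) : S := 0.
  have gz : zmod_morphism g by move=> p q; apply: Seq.
  have gm : monoid_morphism g by split=> [|p q]; apply: Seq.
  pose G : {rmorphism {mpoly R[m]} -> S} := HB.pack g
    (GRing.isZmodMorphism.Build _ S g gz) (GRing.isMonoidMorphism.Build _ S g gm).
  by exists G; split=> c; apply: Seq.
exists (mmap psi x : {rmorphism _ -> _}); split=> [c|i] /=.
  by rewrite mmapC.
by rewrite mmapX mmap1U.
Qed.

Lemma mpoly_homE (R : comNzRingType) (m : nat) (S : comPzRingType)
    (phi : {rmorphism {mpoly R[m]} -> S}) (p : {mpoly R[m]}) :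
  phi p = \sum_(e <- msupp p) phi (p@_e)%:MP * \prod_i phi 'X_i ^+ e i.
Proof.
rewrite {1}[p]mpolyE rmorph_sum; apply: eq_bigr => e _.
rewrite -mul_mpolyC rmorphM mpolyXE_id rmorph_prod; congr (_ * _).
by apply: eq_bigr => i _; rewrite rmorphXn.
Qed.

Lemma eq_mpoly_hom (R : comNzRingType) (m : nat) (S : comPzRingType)
    (f g : {rmorphism {mpoly R[m]} -> S}) :
  (forall c, f c%:MP = g c%:MP) -> (forall i, f 'X_i = g 'X_i) -> f =1 g.
Proof.
move=> fgC fgX p; rewrite !mpoly_homE; apply: eq_bigr => e _.
by rewrite fgC; congr (_ * _); apply: eq_bigr => i _; rewrite fgX.
Qed.

(** As [q] is homogeneous, only the part of degree k of [p] contributes to degree k + d. *)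
Lemma pihomogM (R : comNzRingType) (n k d : nat) (p q : {mpoly R[n]}) :
  q \is d.-homog ->
  pihomog mdeg (k + d) (p * q) = pihomog mdeg k p * q.
Proof.
move=> hq; have le : (mmeasure mdeg p <= maxn (msize p) k.+1)%N by apply: leq_maxl.
rewrite {1}(pihomog_partitionE le) mulr_suml raddf_sum.
have ltk : (k < maxn (msize p) k.+1)%N by apply: leq_maxr.
rewrite (bigD1 (Ordinal ltk)) //= big1 ?addr0 => [|e ne].
  by rewrite pihomog_dE // dhomogM // pihomogP.
rewrite (@pihomog_ne0 _ _ _ (e + d)%N) ?dhomogM ?pihomogP //.
by rewrite eqn_add2r; apply: contraNneq ne => ek; apply/eqP/val_inj.
Qed.

Lemma pihomog_dmonE (R : comNzRingType) (N k : nat) (p : {mpoly R[N.+1]}) :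
  exists c : dmon N k -> R,
    pihomog mdeg k p = \sum_(m : dmon N k) (c m)%:MP * \prod_j 'X_j ^+ dmon_exp m j.
Proof.
set q := pihomog _ _ _; have hq : q \is k.-homog by apply: pihomogP.
exists (fun m : dmon N k => q@_(val (val m))); rewrite -{1}(pihomog_dE hq).
rewrite (@pihomogwE _ _ _ _ k.+1); last first.
  rewrite msizeE; apply/bigmax_leqP_seq => m mq _.
  by rewrite (dhomog_mf hq mq).
rewrite -(@big_sub _ _ _ _ [pred m : 'X_{1..N.+1 < k.+1} | mdeg m == k]
  (fun m => (q@_m)%:MP * \prod_j 'X_j ^+ (m : 'X_{1..N.+1}) j)).
by apply: eq_bigr => m _; rewrite -mul_mpolyC mpolyXE_id.
Qed.

(** [eval_coefs] is a bare formula; this identifies it with the specialization of the generic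
    coefficients, which is a ring morphism. *)
Lemma eval_coefsE (S : comPzRingType) (N d : nat) (F : forms S N d)
    (phi : {rmorphism coefring N d -> S}) (r : coefring N d) :
  (forall i m, phi 'X_(enum_rank (i, m)) = F i m) -> phi r = eval_coefs r F.
Proof.
move=> phiX; rewrite mpoly_homE; apply: eq_bigr => e _; congr (_ * _).
  by have := rmorph_int (phi \o @mpolyC (ncoef N d) int) r@_e; rewrite intz.
apply: eq_bigr => l _; rewrite -phiX; congr (phi 'X_ _ ^+ _).
by rewrite -surjective_pairing enum_valK.
Qed.

Lemma generic_poly_homog (N d : nat) (i : 'I_N.+1) : generic_poly d i \is d.-homog.
Proof.
rewrite /generic_poly mxE; apply: rpred_sum => m _.
rewrite mul_mpolyC dhomogZ //.
under eq_bigr do rewrite mxE.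
by rewrite -mpolyXE_id dhomogX; case: m.
Qed.

(** The resultant [r] generates the elimination ideal and so lies in it: r x_j^k is a combination of
    the generic forms. Specializing the coefficients to those of [G] turns r into a unit of [R], and
    dividing by it gives an identity that holds over every R-algebra. *)
Lemma unit_resultantP (R : comPzRingType) (N d : nat) (G : forms R N d) :
  unit_resultant G ->
  exists k (Q : 'I_N.+1 -> forms R N k),
    forall (T : comPzRingType) (psi : {rmorphism R -> T}) (w : 'cV[T]_N.+1) j,
      w j 0 ^+ (k + d) =
      \sum_i eval_forms (map_forms psi (Q j)) w i 0
             * eval_forms (map_forms psi G) w i 0.
Proof.
case=> r [[/(_ r)[_ elimr] _] [u ur]].
have {elimr}[k Qk] : elimination_ideal r by apply: elimr; exists 1; rewrite mul1r.
have [phi [_ phiX]] := mpoly_hom_exists (intr : {rmorphism int -> R})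
  (fun l : 'I_(ncoef N d) => G (enum_val l).1 (enum_val l).2).
have phiG i m : phi 'X_(enum_rank (i, m)) = G i m by rewrite phiX enum_rankK.
have phir := eval_coefsE r phiG.
have Qj j : exists c : 'I_N.+1 -> dmon N k -> coefring N d,
    r%:MP * 'X_j ^+ (k + d) =
    \sum_i (\sum_(m : dmon N k) (c i m)%:MP * \prod_j 'X_j ^+ dmon_exp m j)
      * generic_poly d i.
  have [Q rQ] := Qk j.
  (* The extra factor x_j^d allows cofactors of degree [k], even when k < d: taking the part of
     degree k + d makes them homogeneous. *)
  have /(congr1 (pihomog mdeg (k + d))) :
      r%:MP * 'X_j ^+ (k + d) = \sum_i (Q i * 'X_j ^+ d) * generic_poly d i.
    rewrite exprD mulrA rQ mulr_suml; apply: eq_bigr => i _.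
    by rewrite -!mulrA [_ * 'X_j ^+ d]mulrC.
  rewrite pihomog_dE; last first.
    rewrite mul_mpolyC dhomogZ // -[X in X.-homog]mul1n dhomogMn //.
    by rewrite dhomogX; apply/eqP; apply: mdeg1.
  rewrite raddf_sum => ->.
  have [c cE] := fin_all_exists (fun i => pihomog_dmonE k (Q i * 'X_j ^+ d)).
  exists c; apply: eq_bigr => i _.
  by rewrite /= pihomogM ?generic_poly_homog // cE.
have [c cE] := fin_all_exists Qj.
exists k, (fun j i m => u * phi (c j i m)) => T psi w j.
have [ev [evC evX]] := mpoly_hom_exists (psi \o phi) (fun j => w j 0).
have /(congr1 ev) := cE j.
rewrite rmorphM rmorphXn evX evC /= phir => e.
have -> : w j 0 ^+ (k + d) = psi u * (psi (eval_coefs r G) * w j 0 ^+ (k + d)).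
  by rewrite mulrA -rmorphM ur rmorph1 mul1r.
have vX : map_mx ev (\col_j 'X_j) = w.
  by apply/matrixP => i l; rewrite !mxE evX (ord1 l).
rewrite e rmorph_sum mulr_sumr; apply: eq_bigr => i _.
rewrite rmorphM mulrA; congr (_ * _).
  rewrite mxE rmorph_sum mulr_sumr; apply: eq_bigr => m _.
  rewrite rmorphM evC /= /map_forms rmorphM mulrA; congr (_ * _).
  by rewrite rmorph_prod; apply: eq_bigr => l _; rewrite rmorphXn evX.
rewrite /generic_poly map_eval_formsE vX; congr (eval_forms _ _ _ _).
apply: boolp.funext => i'; apply: boolp.funext => m.
by rewrite /map_forms evC /= phiG.
Qed.

(** * Points of PGL as tensors *)

Lemma span_ind (S : comPzRingType) (a b : nat) (A W : 'M[S]_(a, b) -> Prop) :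
  W 0 -> (forall X Y, W X -> W Y -> W (X + Y)) ->
  (forall c X, A X -> W (c *: X)) -> forall X, span A X -> W X.
Proof.
move=> W0 WD WA X [k [c [Y [AY ->]]]].
by apply: big_ind => // i _; apply: WA.
Qed.

Lemma span_gen (S : comPzRingType) (a b : nat) (A : 'M[S]_(a, b) -> Prop) c X :
  A X -> span A (c *: X).
Proof.
move=> AX; exists 1%N, (fun=> c), (fun=> X); split=> //.
by rewrite big_ord1.
Qed.

Lemma span_gen1 (S : comPzRingType) (a b : nat) (A : 'M[S]_(a, b) -> Prop) X :
  A X -> span A X.
Proof. by move=> AX; rewrite -[X]scale1r; apply: span_gen. Qed.

Lemma span0 (S : comPzRingType) (a b : nat) (A : 'M[S]_(a, b) -> Prop) : span A 0.
Proof.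
exists 0%N, (fun=> 0), (fun=> 0); split=> [[]//|].
by rewrite big_ord0.
Qed.

Lemma spanD (S : comPzRingType) (a b : nat) (A : 'M[S]_(a, b) -> Prop) X Y :
  span A X -> span A Y -> span A (X + Y).
Proof.
case=> [k [c [U [AU ->]]]] [m [e [V [AV ->]]]].
pose pick T (f : 'I_k -> T) (g : 'I_m -> T) (i : 'I_(k + m)) :=
  match split i with inl i => f i | inr i => g i end.
exists (k + m)%N, (pick _ c e), (pick _ U V).
split=> [i|]; first by rewrite /pick; case: split.
rewrite big_split_ord; congr (_ + _); apply: eq_bigr => i _; rewrite /pick.
  by rewrite (unsplitK (inl _ i)).
by rewrite (unsplitK (inr _ i)).
Qed.

Lemma spanZ (S : comPzRingType) (a b : nat) (A : 'M[S]_(a, b) -> Prop) t X :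
  span A X -> span A (t *: X).
Proof.
case=> [k [c [Y [AY ->]]]]; exists k, (fun i => t * c i), Y; split=> //.
by rewrite scaler_sumr; apply: eq_bigr => i _; rewrite scalerA.
Qed.

Section Tensors.
Variable N : nat.

Definition tensor (S : Type) := 'I_N.+1 -> 'I_N.+1 -> 'I_N.+1 -> 'I_N.+1 -> S.

Definition map_tensor (S T : Type) (h : S -> T) (p : tensor S) : tensor T :=
  fun i j k l => h (p i j k l).

(** If p_ijkl = a_ij b_kl with B = A^-1, then [lslice p k l] is b_kl A and [rslice p i j] is a_ij B.
    Both are unchanged when A is rescaled. *)
Definition lslice (S : Type) (p : tensor S) k l : 'M[S]_N.+1 :=
  \matrix_(i, j) p i j k l.
Definition rslice (S : Type) (p : tensor S) i j : 'M[S]_N.+1 :=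
  \matrix_(k, l) p i j k l.

(* Over a local ring these are the tensors A (x) A^-1 with A invertible. *)
Definition pgl_tensor (S : comPzRingType) (p : tensor S) : Prop :=
  [/\ forall i j k l i' j' k' l',
        p i j k l * p i' j' k' l' = p i' j' k l * p i j k' l',
      forall i l, \sum_j p i j j l = (i == l)%:R
    & forall k j, \sum_i p i j k i = (k == j)%:R].

(** For p = A (x) B, sending X to the sum of the X_0l b_l0 A is a projector onto the line of A,
    because the a_0l b_l0 add up to 1. Its fixed points describe this line without a choice of A. *)
Definition pgl_sub (S : comPzRingType) (p : tensor S) (X : 'M[S]_N.+1) : Prop :=
  X = \sum_l X ord0 l *: lslice p l ord0.

Lemma map_lslice (S T : Type) (h : S -> T) (p : tensor S) k l :
  map_mx h (lslice p k l) = lslice (map_tensor h p) k l.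
Proof. by apply/matrixP => i j; rewrite !mxE. Qed.

Lemma map_rslice (S T : Type) (h : S -> T) (p : tensor S) k l :
  map_mx h (rslice p k l) = rslice (map_tensor h p) k l.
Proof. by apply/matrixP => i j; rewrite !mxE. Qed.

Lemma map_pgl_tensor (S T : comPzRingType) (h : {rmorphism S -> T}) (p : tensor S) :
  pgl_tensor p -> pgl_tensor (map_tensor h p).
Proof.
case=> seg c1 c2; split=> [i j k l i' j' k' l'|i l|k j]; rewrite /map_tensor.
- by rewrite -!rmorphM seg.
- by rewrite -rmorph_sum c1 rmorph_nat.
- by rewrite -rmorph_sum c2 rmorph_nat.
Qed.

Section OneRing.
Variables (S : comPzRingType) (p : tensor S).

Lemma pgl_subE (X : 'M[S]_N.+1) :
  pgl_sub p X <-> forall i j, X i j = \sum_l X ord0 l * p i j l ord0.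
Proof.
split=> [XE i j|XE].
  by rewrite {1}XE summxE; apply: eq_bigr => l _; rewrite !mxE.
apply/matrixP => i j; rewrite summxE XE.
by apply: eq_bigr => l _; rewrite !mxE.
Qed.

Lemma pgl_sub0 : pgl_sub p 0.
Proof. by apply/pgl_subE => i j; rewrite mxE big1 // => l _; rewrite mxE mul0r. Qed.

Lemma pgl_subD X Y : pgl_sub p X -> pgl_sub p Y -> pgl_sub p (X + Y).
Proof.
move=> /pgl_subE pX /pgl_subE pY; apply/pgl_subE => i j; rewrite mxE pX pY -big_split.
by apply: eq_bigr => l _; rewrite mxE mulrDl.
Qed.

Lemma pgl_subZ a X : pgl_sub p X -> pgl_sub p (a *: X).
Proof.
move=> /pgl_subE pX; apply/pgl_subE => i j; rewrite mxE pX mulr_sumr.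
by apply: eq_bigr => l _; rewrite mxE mulrA.
Qed.

Hypothesis pglp : pgl_tensor p.
Let seg : forall i j k l i' j' k' l',
  p i j k l * p i' j' k' l' = p i' j' k l * p i j k' l'.
Proof. by case: pglp. Qed.
Let contr1 : forall i l, \sum_j p i j j l = (i == l)%:R.
Proof. by case: pglp. Qed.
Let contr2 : forall k j, \sum_i p i j k i = (k == j)%:R.
Proof. by case: pglp. Qed.

Lemma lslice_sub k l : pgl_sub p (lslice p k l).
Proof.
apply/pgl_subE => i j; rewrite mxE.
under eq_bigr do rewrite mxE seg.
by rewrite -mulr_sumr contr1 mulr1.
Qed.

Lemma pgl_sub_exchange X : pgl_sub p X ->
  forall i j i' j' k l, X i j * p i' j' k l = X i' j' * p i j k l.
Proof.
move=> /pgl_subE pX i j i' j' k l; rewrite pX [X i' j']pX !mulr_suml.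
by apply: eq_bigr => m _; rewrite -!mulrA seg.
Qed.

Lemma mul_lslice_rslice k l i j : lslice p k l *m rslice p i j = (p i j k l)%:M.
Proof.
apply/matrixP => a b; rewrite !mxE.
under eq_bigr do rewrite !mxE seg.
by rewrite -mulr_sumr contr1 mulr_natr.
Qed.

Lemma mul_rslice_lslice k l i j : rslice p i j *m lslice p k l = (p i j k l)%:M.
Proof.
apply/matrixP => a b; rewrite !mxE.
under eq_bigr do rewrite !mxE seg mulrC.
by rewrite -mulr_sumr contr2 mulr_natr.
Qed.

Lemma pivot_sum1 : \sum_j p ord0 j j ord0 = 1.
Proof. by rewrite contr1 eqxx. Qed.

Lemma pgl_sub_pivot X j : pgl_sub p X ->
  p ord0 j j ord0 *: X = X ord0 j *: lslice p j ord0.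
Proof.
move=> pX; apply/matrixP => i' j'; rewrite !mxE mulrC.
by rewrite (pgl_sub_exchange pX).
Qed.

Lemma rslice_pivot i j' j :
  p ord0 j j ord0 *: rslice p i j' = p i j' j ord0 *: rslice p ord0 j.
Proof. by apply/matrixP => k l; rewrite !mxE seg. Qed.

Definition pgl_proj : 'M[S]_(N.+1 * N.+1) :=
  \sum_l (mxvec (delta_mx ord0 l))^T *m mxvec (lslice p l ord0).

Lemma mul_pgl_proj X :
  mxvec X *m pgl_proj = mxvec (\sum_l X ord0 l *: lslice p l ord0).
Proof.
rewrite mulmx_sumr linear_sum; apply: eq_bigr => l _.
rewrite mulmxA mxvec_delta trmx_delta -colE linearZ /=.
apply/matrixP => i j; rewrite (ord1 i) !mxE big_ord1 !mxE.
by rewrite mxvecE.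
Qed.

Lemma pgl_sub_proj X : pgl_sub p X <-> mxvec X *m pgl_proj = mxvec X.
Proof.
rewrite mul_pgl_proj /pgl_sub; split=> [<-//|/(can_inj mxvecK) e].
by rewrite {1}e.
Qed.

Lemma pgl_proj_idem : pgl_proj *m pgl_proj = pgl_proj.
Proof.
apply/row_matrixP => i; rewrite row_mul -[row i pgl_proj]vec_mxK.
rewrite -[LHS]/(_ *m _); apply/pgl_sub_proj.
rewrite rowE -[delta_mx _ _]vec_mxK mul_pgl_proj mxvecK.
apply: (big_ind (pgl_sub p)); [exact: pgl_sub0|exact: pgl_subD|].
by move=> l _; apply/pgl_subZ/lslice_sub.
Qed.

End OneRing.

Lemma map_pgl_proj (S T : comPzRingType) (h : {rmorphism S -> T}) (p : tensor S) :
  map_mx h (pgl_proj p) = pgl_proj (map_tensor h p).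
Proof.
rewrite map_mx_sum; apply: eq_bigr => l _.
by rewrite map_mxM -map_trmx !map_mxvec map_delta_mx map_lslice.
Qed.

Lemma pgl_pivot_neq0 (K : fieldType) (p : tensor K) :
  pgl_tensor p -> exists j, p ord0 j j ord0 != 0.
Proof.
move=> pglp; apply/existsP; apply: contraT; rewrite negb_exists => /forallP p0.
have /eqP := pivot_sum1 pglp; rewrite big1 ?(eq_sym 0) ?oner_eq0 // => j _.
by apply/eqP; have := p0 j; rewrite negbK.
Qed.

Lemma rank_pgl_proj (K : fieldType) (p : tensor K) :
  pgl_tensor p -> \rank (pgl_proj p) = 1%N.
Proof.
move=> pglp; have [j fj] := pgl_pivot_neq0 pglp.
apply/eqP; rewrite eqn_leq; apply/andP; split; last first.
  rewrite lt0n mxrank_eq0; apply: contraNneq fj => P0.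
  have := (pgl_sub_proj p _).1 (lslice_sub pglp j ord0).
  rewrite P0 mulmx0 => /esym/eqP; rewrite -(linear0 (mxvec)) (can_eq mxvecK).
  by move=> /eqP/matrixP/(_ ord0 j); rewrite !mxE => ->.
set r := mxvec (lslice p j ord0).
suff -> : pgl_proj p = (\sum_l ((p ord0 j j ord0)^-1 * p ord0 j l ord0) *:
     (mxvec (delta_mx ord0 l))^T) *m r.
  by apply: leq_trans (mxrankM_maxr _ _) _; apply: rank_leq_row.
rewrite mulmx_suml; apply: eq_bigr => l _.
rewrite -scalemxAl scalemxAr; congr (_ *m _).
rewrite -linearZ /=; congr mxvec; rewrite -scalerA.
have := pgl_sub_pivot pglp j (lslice_sub pglp l ord0); rewrite mxE => <-.
by rewrite scalerA mulVf ?scale1r.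
Qed.

Lemma base_change_pgl_sub (S T : comPzRingType) (h : {rmorphism S -> T})
    (p : tensor S) : pgl_tensor p ->
  base_change h (pgl_sub p) = pgl_sub (map_tensor h p).
Proof.
move=> pglp; apply: same_subE => X; split.
  apply: span_ind; [exact: pgl_sub0|exact: pgl_subD|].
  move=> c _ [Y /pgl_subE pY ->]; apply/pgl_subZ/pgl_subE => i j.
  rewrite mxE pY rmorph_sum; apply: eq_bigr => l _.
  by rewrite rmorphM mxE.
move=> ->; exists N.+1, (fun l => X ord0 l), (fun l => lslice (map_tensor h p) l ord0).
by split=> // l; exists (lslice p l ord0); [apply: lslice_sub|rewrite map_lslice].
Qed.

(** This is the uniqueness of inverses: the relation A B = 1 of [p] is inserted into [q], the
    exchange relation swaps the A-indices of the two tensors, and the relation B A = 1 of [q]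
    contracts what remains. *)
Lemma pgl_sub_inj (S : comPzRingType) (p q : tensor S) :
  pgl_tensor p -> pgl_tensor q -> pgl_sub p = pgl_sub q ->
  forall i j k l, p i j k l = q i j k l.
Proof.
move=> pglp pglq pq i j k l; have [_ c1 _] := pglp; have [_ _ c2] := pglq.
transitivity (\sum_m q i j k m * \sum_j' p m j' j' l); last first.
  under eq_bigr do rewrite c1.
  rewrite (bigD1 l) //= eqxx mulr1 big1 ?addr0 // => m /negPf ->.
  by rewrite mulr0.
under eq_bigr do rewrite mulr_sumr.
rewrite exchange_big /=.
transitivity (\sum_j' p i j j' l * \sum_m q m j' k m).
  under eq_bigr do rewrite c2.
  rewrite (bigD1 k) //= eqxx mulr1 big1 ?addr0 // => m; rewrite eq_sym => /negPf ->.
  by rewrite mulr0.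
apply: eq_bigr => j' _; rewrite mulr_sumr; apply: eq_bigr => m _.
have qkm : pgl_sub p (lslice q k m) by rewrite pq; apply: lslice_sub.
by have := pgl_sub_exchange pglp qkm i j m j' j' l; rewrite !mxE => ->; rewrite mulrC.
Qed.

Lemma pgl_sub_PGL_point (S : comPzRingType) (p : tensor S) :
  pgl_tensor p -> PGL_point (pgl_sub p).
Proof.
move=> pglp; split.
  exists (pgl_proj p); split; first exact: pgl_proj_idem.
    exact: pgl_sub_proj.
  by move=> K h; rewrite map_pgl_proj rank_pgl_proj //; apply: map_pgl_tensor.
move=> K h; have pglh := map_pgl_tensor h pglp; have [j fj] := pgl_pivot_neq0 pglh.
exists (lslice p j ord0); first exact: lslice_sub.
rewrite map_lslice; have := mul_lslice_rslice pglh j ord0 ord0 j.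
move=> /(congr1 (mulmx^~ ((map_tensor h p ord0 j j ord0)^-1)%:M)).
rewrite -mulmxA -scalar_mxM mulfV // => /mulmx1_unit[]//.
Qed.

End Tensors.

(** * From points of PGL to tensors *)

Lemma big_antisym (S : comPzRingType) (m : nat) (f : 'I_m -> 'I_m -> S) :
  \sum_x \sum_y f x y =
  \sum_(x < m) \sum_(y < m | (x < y)%N) (f x y + f y x) + \sum_x f x x.
Proof.
have split1 x : \sum_y f x y =
    \sum_(y < m | (x < y)%N) f x y + (\sum_(y < m | (y < x)%N) f x y + f x x).
  rewrite (bigID (fun y : 'I_m => (x < y)%N)) /=; congr (_ + _).
  rewrite (bigD1 x) ?ltnn //= addrC; congr (_ + _).
  apply: eq_bigl => y; rewrite -leqNgt ltn_neqAle andbC.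
  by rewrite -(inj_eq val_inj).
under eq_bigr do rewrite split1.
rewrite !big_split /= addrA; congr (_ + _).
under [RHS]eq_bigr do rewrite big_split /=.
rewrite big_split /=; congr (_ + _).
by rewrite (exchange_big_dep xpredT).
Qed.

Lemma rank1_minors (K : fieldType) (m : nat) (P : 'M[K]_m) :
  \rank P = 1%N -> forall a b c e, P a c * P b e = P a e * P b c.
Proof.
move=> rP a b c e; have := mulmx_base P.
move: (col_base P) (row_base P); rewrite rP => u v <-.
by rewrite !mxE !big_ord1 mulrACA [_ * (u b _ * _)]mulrACA [v _ e * _]mulrC.
Qed.

(* Nakayama by determinants: the vector w of 2x2 minors in the columns c, e
   satisfies w = Theta w by Cauchy-Binet, and Theta vanishes at field points. *)
Lemma idempotent_minors (S : comPzRingType) (m : nat) (P : 'M[S]_m) :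
  P *m P = P ->
  (forall (K : fieldType) (h : {rmorphism S -> K}), \rank (map_mx h P) = 1%N) ->
  forall a b c e, P a c * P b e = P a e * P b c.
Proof.
move=> PP rP; pose minor a b c e := P a c * P b e - P a e * P b c.
suff min0 a b c e : minor a b c e = 0.
  by move=> a b c e; apply/eqP; rewrite -subr_eq0; apply/eqP/min0.
pose I := ('I_m * 'I_m)%type.
pose w : 'cV[S]_#|{: I}| := \col_x minor (enum_val x).1 (enum_val x).2 c e.
(* Indices run over all pairs; the columns of pairs that are not increasing are set to zero, so that
   each choice of two columns counts once. *)
pose Th : 'M[S]_#|{: I}| := \matrix_(x, y)
  (minor (enum_val x).1 (enum_val x).2 (enum_val y).1 (enum_val y).2
    *+ ((enum_val y).1 < (enum_val y).2)%N).
have PE a' c' : P a' c' = \sum_x P a' x * P x c' by rewrite -{1}PP mxE.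
have wTh : Th *m w = w.
  apply/matrixP => x z; rewrite !mxE; case ex: (enum_val x) => [a' b'] /=.
  rewrite (reindex (@enum_rank I)) /=; last exact/onW_bij/enum_rank_bij.
  under eq_bigr do rewrite !mxE !enum_rankK ex.
  rewrite -(pair_bigA _ (fun y1 y2 =>
    (minor a' b' y1 y2 *+ (y1 < y2)%N) * minor y1 y2 c e)) /=.
  have -> : minor a' b' c e =
      \sum_y1 \sum_y2 P a' y1 * P b' y2 * minor y1 y2 c e.
    rewrite /minor (PE a' c) (PE b' e) (PE a' e) (PE b' c) !mulr_suml.
    rewrite -sumrB; apply: eq_bigr => y1 _; rewrite !mulr_sumr -sumrB.
    apply: eq_bigr => y2 _.
    by rewrite mulrACA [X in _ - X]mulrACA -mulrBr.
  (* Cauchy-Binet: exchanging y1 and y2 changes the sign of the minor of P in the columns c and e,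
     so the terms pair up into minors and the diagonal ones vanish. *)
  rewrite [RHS]big_antisym [X in _ = _ + X]big1 ?addr0; last first.
    by move=> y _; rewrite /minor [P y e * _]mulrC subrr mulr0.
  apply: eq_bigr => y1 _; rewrite [RHS]big_mkcond; apply: eq_bigr => y2 _.
  case: (y1 < y2)%N; last by rewrite mulr0n mul0r.
  rewrite mulr1n /minor.
  rewrite mulrBl; congr (_ + _).
  by rewrite [P y2 c * _]mulrC [P y2 e * _]mulrC -[X in _ = _ * X]opprB mulrN.
(* D w = adj(1 - Theta) (1 - Theta) w = 0, and D becomes 1 at every field point, so D generates the
   unit ideal. *)
pose D := \det (1%:M - Th).
have Dw : D *: w = 0.
  rewrite -mul_scalar_mx -mul_adj_mx -mulmxA mulmxBl mul1mx wTh subrr.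
  by rewrite mulmx0.
have D1 : exists y, 1 = y * D.
  apply: (@ideal_has1 _ (fun z => exists y, z = y * D)).
    split=> [|_ _ [x ->] [y ->]|z _ [y ->]].
    - by exists 0; rewrite mul0r.
    - by exists (x + y); rewrite mulrDl.
    - by exists (z * y); rewrite mulrA.
  move=> K h; exists D; first by exists 1; rewrite mul1r.
  rewrite -det_map_mx map_mxB map_mx1.
  suff -> : map_mx h Th = 0 by rewrite subr0 det1 oner_eq0.
  apply/matrixP => x y; rewrite !mxE rmorphMn rmorphB !rmorphM.
  have := rank1_minors (rP K h) (enum_val x).1 (enum_val x).2
            (enum_val y).1 (enum_val y).2.
  by rewrite !mxE => ->; rewrite subrr mul0rn.
have [y y1] := D1.
have /matrixP/(_ (enum_rank (a, b)) 0) : w = 0.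
  by rewrite -[w]scale1r y1 -scalerA Dw scaler0.
by rewrite !mxE enum_rankK.
Qed.

(** Consider the ideal of those z for which some tensor has all its left slices in [al] and
    contracts to z in place of 1. It contains det M for M in [al], by M (x) adj M, and at each field
    point some such determinant is nonzero; so it contains 1. The Segre relations hold because
    elements of [al] are pairwise proportional. *)
Lemma PGL_point_tensor (N : nat) (S : comPzRingType) (al : 'M[S]_N.+1 -> Prop) :
  PGL_point al -> exists2 p : tensor N S, pgl_tensor p & al = pgl_sub p.
Proof.
case=> -[P [PP alP rP]] alU.
have al0 : al 0 by apply/alP; rewrite linear0 mul0mx.
have alD X Y : al X -> al Y -> al (X + Y).
  by move=> /alP aX /alP aY; apply/alP; rewrite linearD mulmxDl /= aX aY.
have alZ c X : al X -> al (c *: X).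
  by move=> /alP aX; apply/alP; rewrite linearZ -scalemxAl /= aX.
have minP := idempotent_minors PP rP.
(* As row vectors, elements of [al] are combinations of the rows of P, whose 2x2 minors vanish. *)
have alx X Y : al X -> al Y ->
    forall i j i' j', X i j * Y i' j' = X i' j' * Y i j.
  move=> /alP aX /alP aY i j i' j'.
  rewrite -(mxvecE X i j) -(mxvecE Y i' j') -(mxvecE X i' j') -(mxvecE Y i j).
  rewrite -aX -aY !mxE !mulr_suml; apply: eq_bigr => x _; rewrite !mulr_sumr.
  apply: eq_bigr => y _.
  by rewrite mulrACA minP mulrACA.
pose I z := exists q : tensor N S, [/\ forall k l, al (lslice q k l),
    forall i l, \sum_j q i j j l = z *+ (i == l)
  & forall k j, \sum_i q i j k i = z *+ (k == j)].
have [q [alq c1 c2]] : I 1.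
  apply: ideal_has1.
    split=> [|x y [q [aq c1 c2]] [q' [aq' c1' c2']]|a x [q [aq c1 c2]]].
    - exists (fun _ _ _ _ => 0); split=> [k l|i l|k j]; last 2 first.
      + by rewrite big1 // mul0rn.
      + by rewrite big1 // mul0rn.
      by rewrite [lslice _ _ _](_ : _ = 0) //; apply/matrixP => i j; rewrite !mxE.
    - exists (fun i j k l => q i j k l + q' i j k l); split=> [k l|i l|k j].
      + rewrite [lslice _ _ _](_ : _ = lslice q k l + lslice q' k l); first exact: alD.
        by apply/matrixP => i j; rewrite !mxE.
      + by rewrite big_split /= c1 c1' mulrnDl.
      + by rewrite big_split /= c2 c2' mulrnDl.
    - exists (fun i j k l => a * q i j k l); split=> [k l|i l|k j].
      + rewrite [lslice _ _ _](_ : _ = a *: lslice q k l); first exact: alZ.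
        by apply/matrixP => i j; rewrite !mxE.
      + by rewrite -mulr_sumr c1 mulrnAr.
      + by rewrite -mulr_sumr c2 mulrnAr.
  move=> K h; have [M aM uM] := alU K h; exists (\det M); last first.
    by rewrite -det_map_mx -unitfE -unitmxE.
  exists (fun i j k l => M i j * \adj M k l); split=> [k l|i l|k j].
  - rewrite [lslice _ _ _](_ : _ = \adj M k l *: M); first exact: alZ.
    by apply/matrixP => i j; rewrite !mxE mulrC.
  - by have /matrixP/(_ i l) := mul_mx_adj M; rewrite !mxE.
  - have /matrixP/(_ k j) := mul_adj_mx M; rewrite !mxE => <-.
    by apply: eq_bigr => i _; rewrite mulrC.
have seg i j k l i' j' k' l' : q i j k l * q i' j' k' l' = q i' j' k l * q i j k' l'.
  by have := alx _ _ (alq k l) (alq k' l') i j i' j'; rewrite !mxE.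
have pglq : pgl_tensor q by split=> // [i l|k j]; rewrite (c1, c2).
exists q => //; apply: same_subE => X; split=> [aX|->].
  apply/pgl_subE => i j.
  have -> : X i j = \sum_l X i j * q ord0 l l ord0.
    by rewrite -mulr_sumr c1 eqxx mulr1.
  apply: eq_bigr => l _.
  by have := alx _ _ aX (alq l ord0) i j ord0 l; rewrite !mxE.
by apply: (big_ind al) => // l _; apply/alZ.
Qed.

(** * The equations of conjugation *)

(** The form in which a unit resultant is used from now on. Quantifying over all [T] makes it stable
    under base change and applicable at the generic point. *)
Definition eliminable (S : comPzRingType) (N d : nat) (G : forms S N d) : Prop :=
  exists k (Q : 'I_N.+1 -> forms S N k),
    forall (T : comPzRingType) (h : {rmorphism S -> T}) (w : 'cV[T]_N.+1) j,
      w j 0 ^+ (k + d) =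
      \sum_i eval_forms (map_forms h (Q j)) w i 0 * eval_forms (map_forms h G) w i 0.

Lemma unit_resultant_eliminable (R S : comPzRingType) (psi : {rmorphism R -> S})
    (N d : nat) (G : forms R N d) :
  unit_resultant G -> eliminable (map_forms psi G).
Proof.
case/unit_resultantP => k [Q QE]; exists k, (fun j => map_forms psi (Q j)).
by move=> T h w j; apply: (QE T (h \o psi)).
Qed.

(** [G] has no zero at (1 : 0 : ... : 0). An identity with an unwanted factor G_i(e_0) is later
    summed with the weights [c], which removes that factor. *)
Lemma eliminable1 (S : comPzRingType) (N d : nat) (G : forms S N d) :
  eliminable G ->
  exists c : 'I_N.+1 -> S, \sum_i c i * eval_forms G (delta_mx 0 0) i 0 = 1.
Proof.
case=> k [Q /(_ S idfun (delta_mx 0 0) 0)]; rewrite mxE !eqxx expr1n => QE.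
by exists (fun i => eval_forms (map_forms idfun (Q 0)) (delta_mx 0 0) i 0).
Qed.

Lemma radical_add (S : comPzRingType) (I : S -> Prop) : is_ideal I ->
  forall x y, (exists a, I (x ^+ a)) -> (exists b, I (y ^+ b)) ->
  exists c, I ((x + y) ^+ c).
Proof.
case=> I0 ID IM x y [a Ia] [b Ib]; exists (a + b)%N.
rewrite exprDn; apply: (big_ind I) => // i _; rewrite -mulr_natl; apply/IM.
case: (leqP b i) => bi.
  by rewrite -(subnK bi) exprD mulrA; apply: IM.
have ai : (a <= a + b - i)%N by rewrite -addnBA ?leq_addr // ltnW.
by rewrite -(subnK ai) exprD mulrAC; apply: IM.
Qed.

(** The radical of [I] is an ideal, so it contains the sum 1. This is the gluing tool: [I] will
    consist of the scalars after multiplication by which a statement holds. *)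
Lemma comaximal_powers (S : comPzRingType) (I : S -> Prop) (m : nat)
    (f : 'I_m -> S) :
  is_ideal I -> \sum_j f j = 1 -> (forall j, exists e, I (f j ^+ e)) -> I 1.
Proof.
move=> idI f1 If.
have : exists c, I ((\sum_j f j) ^+ c).
  apply: (big_ind (fun x => exists c, I (x ^+ c))) => [|x y|j _].
  - by exists 1%N; case: idI; rewrite expr1.
  - exact: radical_add.
  - exact: If.
by rewrite f1 => -[c]; rewrite expr1n.
Qed.

Section Conjugation.
Variables (N d : nat).

(* With [p = A (x) A^-1], this says that A F(x) = c G(Ax) and
   F(A^-1 y) = c A^-1 G(y) with the same c, after elimination of c. *)
Definition conj_eqs (T : comPzRingType) (F G : forms T N d) (p : tensor N T)
    (x y : 'cV[T]_N.+1) : Prop :=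
  forall i j k l s t,
    eval_forms G (lslice p k l *m x) s 0 * eval_forms F (rslice p i j *m y) t 0 =
    p i j k l ^+ d.-1 *
      ((lslice p k l *m eval_forms F x) s 0 * (rslice p i j *m eval_forms G y) t 0).

(** Asked over all [T], so that the equations are identities of polynomials in x and y and not only
    of their values over [S]. *)
Definition conj_tensor (S : comPzRingType) (F G : forms S N d) (p : tensor N S) :=
  forall (T : comPzRingType) (h : {rmorphism S -> T}) (x y : 'cV[T]_N.+1),
    conj_eqs (map_forms h F) (map_forms h G) (map_tensor h p) x y.

Section Local.
Variables (T : comPzRingType) (p : tensor N T).
Hypothesis pglp : pgl_tensor p.

Lemma span_local b (A : 'M[T]_(N.+1, b) -> Prop) X :
  (forall j, exists e, span A (p ord0 j j ord0 ^+ e *: X)) -> span A X.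
Proof.
move=> Aj; rewrite -[X]scale1r.
apply: (@comaximal_powers _ (fun t => span A (t *: X)) _ _ _ (pivot_sum1 pglp) Aj).
split=> [|x y|a x].
- by rewrite scale0r; apply: span0.
- by rewrite scalerDl; apply: spanD.
- by rewrite -scalerA; apply: spanZ.
Qed.

Lemma det_pivot i j k l :
  \det (lslice p k l) * \det (rslice p i j) = p i j k l ^+ N.+1.
Proof. by rewrite -det_mulmx mul_lslice_rslice // det_scalar. Qed.

Lemma det_rslice i j k l :
  \det (lslice p k l) *: rslice p i j = p i j k l *: \adj (lslice p k l).
Proof.
rewrite -mul_scalar_mx -mul_adj_mx -mulmxA mul_lslice_rslice //.
by rewrite mul_mx_scalar.
Qed.

(** [PGL_inv] is spanned by adjugates. With f = p_ijkl and A, B the two slices, f^(N+1) B = (det B)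
    (det A) B = (det B) f adj A. *)
Lemma rslice_PGL_inv i j k l :
  PGL_inv (pgl_sub p) (p i j k l ^+ N.+1 *: rslice p i j).
Proof.
rewrite -det_pivot mulrC -scalerA det_rslice scalerA.
by apply: span_gen; exists (lslice p k l) => //; apply: lslice_sub.
Qed.

Lemma PGL_inv_pivot j X : PGL_inv (pgl_sub p) X ->
  exists m, p ord0 j j ord0 ^+ N.+1 *: X = m *: rslice p ord0 j.
Proof.
move: X; apply: span_ind => [|X Y [m mE] [m' mE']|c _ [M pM ->]].
- by exists 0; rewrite scaler0 scale0r.
- by exists (m + m'); rewrite scalerDr mE mE' scalerDl.
(* From f M = M_0j A follows f^N adj M = M_0j^N adj A, the adjugate having degree N for matrices of
   size N + 1. The last factor f turns adj A into (det A) B. *)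
exists (c * (M ord0 j ^+ N * \det (lslice p j ord0))).
rewrite scalerA mulrC -!scalerA det_rslice; congr (_ *: _).
have := congr1 adjugate (pgl_sub_pivot pglp j pM); rewrite !adjZ /= => e.
by rewrite exprS -scalerA e !scalerA mulrC.
Qed.

Variables (F G : forms T N d).

Section Pivot.
Hypothesis elimF : eliminable F.
Hypothesis pFG : forall x y, conj_eqs F G p x y.
Variables (i j k l : 'I_N.+1).
Local Notation f := (p i j k l).
Local Notation A := (lslice p k l).
Local Notation B := (rslice p i j).

Let AB : A *m B = f%:M. Proof. exact: mul_lslice_rslice. Qed.
Let BA : B *m A = f%:M. Proof. exact: mul_rslice_lslice. Qed.

Let scaleE (a : T) (u : 'cV[T]_N.+1) s z : (a *: u) s z = a * u s z.
Proof. by rewrite mxE. Qed.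

(** Take x = B v and y = A e_0 in the equations. As A B = B A = f, the left side is f^d G(v) times
    f^d F(e_0), and the weights of [eliminable1] remove F(e_0). *)
Lemma conj_pivotG : exists t, forall v,
  f ^+ (d + d) *: eval_forms G v = t *: (A *m eval_forms F (B *m v)).
Proof.
have [c c1] := eliminable1 elimF; pose e0 : 'cV[T]_N.+1 := delta_mx 0 0.
exists (f ^+ d.-1 * \sum_t c t * (B *m eval_forms G (A *m e0)) t 0) => v.
apply/matrixP => s z; rewrite (ord1 z) !scaleE.
rewrite -[LHS]mulr1 -c1 mulr_sumr -mulrA mulr_suml mulr_sumr.
apply: eq_bigr => t _.
have := pFG (B *m v) (A *m e0) i j k l s t.
rewrite !mulmxA AB BA !mul_scalar_mx !eval_formsZ !scaleE => e.
transitivity (c t * (f ^+ d * eval_forms G v s 0 * (f ^+ d * eval_forms F e0 t 0))).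
  by rewrite exprD; ring.
by rewrite e; ring.
Qed.

Lemma conj_pivotF : eliminable G -> exists t, forall v,
  f ^+ (d + d) *: (A *m eval_forms F (B *m v)) = t *: eval_forms G v.
Proof.
case/eliminable1 => c c1; pose e0 : 'cV[T]_N.+1 := delta_mx 0 0.
pose t0 := f ^+ d.-1 * \sum_s c s * (A *m eval_forms F (B *m e0)) s 0.
have FE v : f ^+ (d + d) *: eval_forms F v = t0 *: (B *m eval_forms G (A *m v)).
  apply/matrixP => t z; rewrite (ord1 z) !scaleE.
  rewrite -[LHS]mulr1 -c1 mulr_sumr /t0 -mulrA mulr_suml mulr_sumr.
  apply: eq_bigr => s _.
  have := pFG (B *m e0) (A *m v) i j k l s t.
  rewrite !mulmxA AB BA !mul_scalar_mx !eval_formsZ !scaleE => e.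
  transitivity (c s * (f ^+ d * eval_forms G e0 s 0 * (f ^+ d * eval_forms F v t 0))).
    by rewrite exprD; ring.
  by rewrite e; ring.
(* Replacing v by B v in [FE] and applying A yields A B G(A B v) = f f^d G(v). *)
exists (t0 * f * f ^+ d) => v.
rewrite scalemxAr FE -scalemxAr !mulmxA AB !mul_scalar_mx eval_formsZ.
by rewrite !scalerA.
Qed.

End Pivot.

Lemma conj_endo_pgl_sub (L : 'cV[T]_N.+1 -> Prop) :
  eliminable F -> eliminable G -> (forall x y, conj_eqs F G p x y) ->
  L 0 -> (forall v w, L v -> L w -> L (v + w)) -> (forall a v, L v -> L (a *: v)) ->
  conj_endo (pgl_sub p) F L = endo G L.
Proof.
move=> elimF elimG pFG L0 LD LZ; apply: same_subE => X; split; last first.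
  move: X; apply: span_ind => [||c _ [v Lv ->]]; [exact: span0|exact: spanD|].
  apply: spanZ; apply: span_local => j; set f := p _ _ _ _.
  have [t tE] := conj_pivotG elimF pFG ord0 j j ord0.
  (* [conj_pivotG] needs f^(d + d). Moreover B is known to lie in [PGL_inv] only after
     multiplication by f^(N+1), a factor that F raises to the power d. *)
  exists (N.+1 * d + (d + d))%N; rewrite exprD -scalerA tE scalerA mulrC -scalerA.
  apply: spanZ; rewrite exprM scalemxAr -eval_formsZ scalemxAl.
  apply: span_gen1; exists (lslice p j ord0).
  eexists; split; [exact: lslice_sub| |reflexivity].
  apply: span_gen1; eexists; last reflexivity.
  apply: span_gen1; do 2!eexists; split; [|exact: Lv|reflexivity].
  exact: rslice_PGL_inv.
move: X; apply: span_ind => [||c _ [M [u [pM Fu ->]]]]; [exact: span0|exact: spanD|].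
apply: spanZ; move: u Fu; apply: span_ind => [|u w|].
- by rewrite mulmx0; apply: span0.
- by rewrite mulmxDr; apply: spanD.
move=> a _ [z Lz ->]; rewrite -scalemxAr; apply: spanZ; apply: span_local => j.
have [v Lv zv] : exists2 v, L v &
    p ord0 j j ord0 ^+ N.+1 *: z = rslice p ord0 j *m v.
  move: z Lz; apply: span_ind => [|z z' [v Lv e] [v' Lv' e']|b _ [Y [v [pY Lv ->]]]].
  - by exists 0 => //; rewrite scaler0 mulmx0.
  - by exists (v + v'); [apply: LD|rewrite scalerDr e e' mulmxDr].
  have [m mE] := PGL_inv_pivot j pY; exists ((b * m) *: v); first exact: LZ.
  transitivity (b *: ((p ord0 j j ord0 ^+ N.+1 *: Y) *m v)).
    by rewrite -scalemxAl !scalerA mulrC.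
  by rewrite mE -scalemxAl -scalemxAr scalerA.
have [t tE] := conj_pivotF pFG ord0 j j ord0 elimG.
(* The three exponents account for [conj_pivotF], for f M = M_0j A, and for f^(N+1) z = B v inside
   F. *)
exists ((d + d) + (1 + N.+1 * d))%N; rewrite exprD -scalerA [p _ _ _ _ ^+ (1 + _)]exprD.
rewrite -scalerA expr1 exprM [X in _ *: (_ *: X)]scalemxAr -eval_formsZ zv.
rewrite [X in _ *: X]scalemxAl pgl_sub_pivot // -scalemxAl scalerA mulrC -scalerA tE.
by rewrite scalerA; apply: span_gen; exists v.
Qed.

End Local.
End Conjugation.

(** * Conjugation at the generic point *)

Lemma localization (S : comPzRingType) (f : S) :
  exists (T : comPzRingType) (k : {rmorphism S -> T}),
    (exists g, g * k f = 1) /\ (forall x, k x = 0 -> exists m, f ^+ m * x = 0).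
Proof.
elim/nonzero_ring_ind: S f => [S S0|S] f.
  by exists S, idfun; split=> [|x _]; exists 0; apply: zero_ring.
pose I (p : {poly S}) := exists q, p = (f%:P * 'X - 1) * q.
have idI : is_ideal I.
  split=> [|_ _ [p ->] [q ->]|a _ [q ->]].
  - by exists 0; rewrite mulr0.
  - by exists (p + q); rewrite mulrDr.
  - by exists (a * q); rewrite mulrCA.
have [T [pi [_ kerpi]]] := quotient_ring idI.
exists T, (pi \o polyC); split=> [|x /= /kerpi[q xq]].
  exists (pi 'X) => /=; apply/eqP; rewrite -subr_eq0 -rmorphM -(rmorph1 pi) -rmorphB.
  by apply/eqP/kerpi; exists 1; rewrite mulr1 mulrC.
(* Comparing coefficients in x = (f X - 1) q gives q_0 = - x and q_i = f q_(i-1). As [q] is a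
   polynomial, f^i x vanishes for large i. *)
have qE i : q`_i = - (f ^+ i * x).
  have := congr1 (fun p : {poly S} => p`_i) xq.
  rewrite mulrBl mul1r coefB coefC -mulrA coefCM coefXM.
  elim: i => [|i IH] /=.
    by rewrite mulr0 sub0r mul1r => ->; rewrite opprK.
  move/esym/eqP; rewrite subr_eq0 => /eqP <-.
  have := congr1 (fun p : {poly S} => p`_i) xq.
  rewrite mulrBl mul1r coefB coefC -mulrA coefCM coefXM => /IH ->.
  by rewrite mulrN exprS mulrA.
exists (size q); apply: oppr_inj; rewrite -qE oppr0.
exact: nth_default.
Qed.

Lemma PN_point_line (N : nat) (T : comPzRingType) (v : 'cV[T]_N.+1) (g : T) :
  g * v 0 0 = 1 -> PN_point (fun w => exists t, w = t *: v).
Proof.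
(* The matrix of the projector that sends w to w_0 g v, where g is the inverse of v_0. *)
move=> gv; pose P : 'M[T]_(N.+1 * 1) :=
  (mxvec (delta_mx 0 0 : 'cV[T]_N.+1))^T *m mxvec (g *: v).
have PE (w : 'cV[T]_N.+1) : mxvec w *m P = mxvec ((w 0 0 * g) *: v).
  rewrite mulmxA mxvec_delta trmx_delta -colE -scalerA !linearZ /=.
  apply/matrixP => i j; rewrite (ord1 i) !mxE big_ord1 !mxE.
  by rewrite mxvecE mulrCA.
exists P; split.
- apply/row_matrixP => i; rewrite row_mul.
  have [a ->] : exists a, row i P = mxvec (a *: v).
    by rewrite rowE -[delta_mx _ _]vec_mxK PE; eexists.
  by rewrite PE mxE -mulrA [v _ _ * g]mulrC gv mulr1.
- move=> w; rewrite PE; split=> [[t ->]|/(can_inj mxvecK) e].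
    by rewrite mxE -mulrA [v _ _ * g]mulrC gv mulr1.
  by exists (w 0 0 * g).
move=> K h; apply/eqP; rewrite eqn_leq; apply/andP; split.
  rewrite map_mxM; apply: leq_trans (mxrankM_maxr _ _) _; exact: rank_leq_row.
rewrite lt0n mxrank_eq0; apply/eqP => P0.
have := congr1 (map_mx h) (PE v); rewrite map_mxM P0 mulmx0 mulrC gv scale1r.
move=> /matrixP/(_ 0 (mxvec_index 0 0)); rewrite !mxE mxvecE => /esym hv.
have := rmorph1 h; rewrite -gv rmorphM hv mulr0 => /esym/eqP.
by rewrite oner_eq0.
Qed.

Section Homogeneous.
Variables (S : comNzRingType) (n : nat).
Implicit Type p : {mpoly S[n]}.

Lemma dhomog_prodX (I : finType) (y : I -> {mpoly S[n]}) (e : I -> nat) :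
  (forall j, y j \is 1.-homog) -> \prod_j y j ^+ e j \is (\sum_j e j).-homog.
Proof.
move=> hy; apply: (big_ind2 (fun p k => p \is k.-homog)) => [|p k q l|j _].
- exact: dhomog1.
- exact: dhomogM.
by rewrite -[X in X.-homog]mul1n; apply: dhomogMn.
Qed.

Lemma mpolyX_inj p q (m : 'X_{1..n}) : p * 'X_[m] = q * 'X_[m] -> p = q.
Proof.
move=> pq; apply/mpolyP => k; rewrite -(mcoeffMX p m) pq.
exact: mcoeffMX.
Qed.

Lemma mcoeffMX_eq0 p (m k : 'X_{1..n}) i :
  (k i < m i)%N -> (p * 'X_[m])@_k = 0.
Proof.
move=> ki; apply/eqP; rewrite mcoeff_eq0 (perm_mem (msuppMX p m)).
apply/mapP => -[k' _ kE]; move: ki; rewrite kE mnmDE ltnNge.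
by rewrite leq_addr.
Qed.

End Homogeneous.

Lemma eval_forms_homog (S : comNzRingType) (n N d : nat) (F : forms S N d)
    (w : 'cV[{mpoly S[n]}]_N.+1) i :
  (forall j, w j 0 \is 1.-homog) ->
  eval_forms (map_forms (@mpolyC n S) F) w i 0 \is d.-homog.
Proof.
move=> hw; rewrite mxE; apply: rpred_sum => m _.
rewrite mul_mpolyC dhomogZ // -[X in X.-homog](dmon_expE m).
exact: dhomog_prodX.
Qed.

Lemma mulmx_homog (S : comNzRingType) (n a k : nat) (A : 'M[S]_a)
    (w : 'cV[{mpoly S[n]}]_a) i :
  (forall j, w j 0 \is k.-homog) ->
  (map_mx (@mpolyC n S) A *m w) i 0 \is k.-homog.
Proof.
by move=> hw; rewrite mxE; apply: rpred_sum => j _; rewrite mxE mul_mpolyC dhomogZ.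
Qed.

Definition generic_point (S : comNzRingType) (N : nat) : 'cV[{mpoly S[N.+1]}]_N.+1 :=
  \col_j 'X_j.

Lemma generic_point_homog (S : comNzRingType) (N : nat) j : generic_point S N j 0 \is 1.-homog.
Proof. by rewrite mxE dhomogX; apply/eqP; apply: mdeg1. Qed.

(* If [x_j^m = sum_i q_ji g_i] and [h_j = sum_i q_ji H_i], then
   [x_l^m h_0 = x_0^m h_l] for all l, so [h_0 = c x_0^m] by degrees. *)
Lemma proportional_forms (S : comNzRingType) (N d : nat) (G : forms S N d)
    (H : 'I_N.+1 -> {mpoly S[N.+1]}) :
  let g i := eval_forms (map_forms (@mpolyC _ S) G) (generic_point S N) i 0 in
  eliminable G -> (forall i, H i \is d.-homog) ->
  (forall s t, H s * g t = H t * g s) ->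
  exists c, forall i, H i = c%:MP * g i.
Proof.
move=> g [k [Q QE]] hH Hg; set m := (k + d)%N in QE.
pose q j i := eval_forms (map_forms (@mpolyC _ S) (Q j)) (generic_point S N) i 0.
have qE j : 'X_[U_(j) *+ m] = \sum_i q j i * g i.
  by rewrite -mpolyXn; have := QE _ (@mpolyC _ S) (generic_point S N) j; rewrite mxE.
pose h j := \sum_i q j i * H i.
have hh j : h j \is m.-homog.
  apply: rpred_sum => i _; apply: dhomogM => //.
  by apply: eval_forms_homog; apply: generic_point_homog.
have hE l j : H j * 'X_[U_(l) *+ m] = h l * g j.
  rewrite qE mulr_sumr mulr_suml; apply: eq_bigr => i _.
  by rewrite mulrCA Hg mulrA.
have hX l : h ord0 * 'X_[U_(l) *+ m] = h l * 'X_[U_(ord0) *+ m].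
  rewrite (qE ord0) mulr_sumr {1}/h mulr_suml; apply: eq_bigr => i _.
  by rewrite -mulrA hE mulrCA.
have h0E : h ord0 = ((h ord0)@_(U_(ord0) *+ m)%MM)%:MP * 'X_[U_(ord0) *+ m].
  apply/mpolyP => u; rewrite mcoeffCM mcoeffX.
  case: eqVneq => [<-|neu]; first by rewrite mulr1.
  rewrite mulr0; case: (eqVneq (mdeg u) m) => [um|]; last exact: dhomog_nemf_coeff.
  have um0 : (u ord0 <= m)%N by rewrite -um mdegE (bigD1 ord0) //= leq_addr.
  (* A monomial u of degree m other than x_0^m contains some x_l with l different from 0. Then u
     x_l^m has exponent less than m in x_0 and cannot occur in h_l x_0^m = h_0 x_l^m. *)
  have [l l0 ul] : exists2 l, l != ord0 & (0 < u l)%N.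
    apply/exists_inP; apply: contraNT neu; rewrite negb_exists_in => /forall_inP u0.
    apply/eqP/mnmP => i; rewrite mulmnE mnmE.
    have u0' j : j != ord0 -> u j = 0%N.
      by move/u0; rewrite -eqn0Ngt => /eqP.
    case: eqVneq => [<-|]; last by rewrite eq_sym => /u0' ->; rewrite mul0n.
    rewrite mul1n -um mdegE (bigD1 ord0) //= big1 ?addn0 // => j /u0' //.
  rewrite -(mcoeffMX (h ord0) (U_(l) *+ m)%MM) hX.
  apply: (@mcoeffMX_eq0 _ _ _ _ _ ord0).
  rewrite mnmDE !mulmnE !mnmE eqxx (negPf l0) mul0n mul1n add0n.
  rewrite -um mdegE (bigD1 ord0) //= (bigD1 l) //= -[X in (X < _)%N]addn0.
  by rewrite ltn_add2l ltn_addr.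
exists (h ord0)@_(U_(ord0) *+ m)%MM => i; apply: (@mpolyX_inj _ _ _ _ (U_(ord0) *+ m)%MM).
by rewrite hE {1}h0E -!mulrA [_ * g i]mulrC.
Qed.

(** At the generic point with x_0 inverted, the hypothesis makes both sides proportional. Their 2x2
    minors are then killed by a power of x_0, hence vanish in S[x], and [proportional_forms] gives a
    factor in [S]. Every x over every [T] is a specialization of the generic point. *)
Lemma conj_pivot_const (N d : nat) (S : comNzRingType) (p : tensor N S)
    (F G : forms S N d) :
  pgl_tensor p -> eliminable G ->
  (forall (T : comPzRingType) (k : {rmorphism S -> T}) (L : 'cV[T]_N.+1 -> Prop),
     PN_point L -> conj_endo (pgl_sub (map_tensor k p)) (map_forms k F) L
                   = endo (map_forms k G) L) ->
  forall j, exists c, forall (T : comPzRingType) (h : {rmorphism S -> T}) x,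
    h (p ord0 j j ord0) ^+ (N.+1 * d) *:
      (lslice (map_tensor h p) j ord0 *m
         eval_forms (map_forms h F) (rslice (map_tensor h p) ord0 j *m x))
    = h c *: eval_forms (map_forms h G) x.
Proof.
move=> pglp elimG conjFG j.
pose H (T : comPzRingType) (h : {rmorphism S -> T}) x :=
  h (p ord0 j j ord0) ^+ (N.+1 * d) *:
      (lslice (map_tensor h p) j ord0 *m
         eval_forms (map_forms h F) (rslice (map_tensor h p) ord0 j *m x)).
have HE (T : comPzRingType) (h : {rmorphism S -> T}) (U : comPzRingType)
    (k : {rmorphism T -> U}) x i : k (H T h x i 0) = H U (k \o h) (map_mx k x) i 0.
  transitivity ((map_mx k (H T h x)) i 0); first by rewrite [RHS]mxE.
  by rewrite /H map_mxZ rmorphXn map_mxM map_lslice map_eval_forms map_mxM map_rslice.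
pose C : {rmorphism S -> {mpoly S[N.+1]}} := @mpolyC N.+1 S.
pose Hx i := H _ C (generic_point S N) i 0.
pose g i := eval_forms (map_forms C G) (generic_point S N) i 0.
have hH i : Hx i \is d.-homog.
  rewrite /Hx /H mxE -rmorphXn mul_mpolyC dhomogZ // -map_lslice.
  apply: mulmx_homog => a; apply: eval_forms_homog => b; rewrite -map_rslice.
  apply: mulmx_homog; exact: generic_point_homog.
have Hg s t : Hx s * g t = Hx t * g s.
  have [T [k [[v0 v0E] kerk]]] := localization (generic_point S N 0 0).
  pose v := map_mx k (generic_point S N).
  have vv0 : v0 * v 0 0 = 1 by rewrite mxE.
  have pglT := map_pgl_tensor (k \o C) pglp.
  have [a aE] : exists a, H T (k \o C) v = a *: eval_forms (map_forms (k \o C) G) v.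
    have : endo (map_forms (k \o C) G) (fun w => exists t, w = t *: v)
             (H T (k \o C) v).
      rewrite -conjFG; last exact: PN_point_line vv0.
      rewrite /H exprM scalemxAr -eval_formsZ scalemxAl.
      apply: span_gen1; exists (lslice (map_tensor (k \o C) p) j ord0).
      eexists; split; [exact: lslice_sub| |reflexivity].
      apply: span_gen1; eexists; last reflexivity.
      apply: span_gen1; do 2!eexists; split; last reflexivity.
        exact: (rslice_PGL_inv pglT ord0 j j ord0).
      by exists 1; rewrite scale1r.
    move: (H T _ v); apply: span_ind => [|X Y [a ->] [b ->]|b _ [w [a ->] ->]].
    - by exists 0; rewrite scale0r.
    - by exists (a + b); rewrite scalerDl.
    - by exists (b * a ^+ d); rewrite eval_formsZ scalerA.
  have kH i : k (Hx i) = a * eval_forms (map_forms (k \o C) G) v i 0.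
    by rewrite HE aE mxE.
  have kg i : k (g i) = eval_forms (map_forms (k \o C) G) v i 0.
    exact: map_eval_formsE.
  have [|m] := kerk (Hx s * g t - Hx t * g s).
    by rewrite rmorphB !rmorphM !kH !kg; ring.
  rewrite mxE mpolyXn => e; apply/eqP; rewrite -subr_eq0; apply/eqP.
  by apply: (@mpolyX_inj _ _ _ _ (U_(0%R) *+ m)%MM); rewrite mul0r mulrC.
have [c cE] := proportional_forms elimG hH Hg.
exists c => T h x.
have [ev [evC evX]] := mpoly_hom_exists h (fun j => x j 0).
have evx : map_mx ev (generic_point S N) = x.
  by apply/matrixP => i z; rewrite !mxE evX (ord1 z).
have evh : (ev \o C : S -> T) = h by apply: boolp.funext => a; apply: evC.
apply/matrixP => i z; rewrite (ord1 z).
have := congr1 ev (cE i); rewrite /Hx HE evx rmorphM evC map_eval_formsE evx.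
rewrite /H -/C; have -> : map_forms ev (map_forms C G) = map_forms h G.
  by rewrite -evh.
have evh' : (ev \o @mpolyC N.+1 S : S -> T) = h by [].
by rewrite /= evC evh' => ->; rewrite [RHS]mxE.
Qed.

Section PivotEqs.
Variables (N d : nat) (T : comPzRingType) (p : tensor N T) (F G : forms T N d).
Hypotheses (pglp : pgl_tensor p) (elimF : eliminable F) (d_gt0 : (0 < d)%N).
Variables (j : 'I_N.+1) (c : T) (m : nat).
Local Notation f := (p ord0 j j ord0).
Local Notation A := (lslice p j ord0).
Local Notation B := (rslice p ord0 j).
Hypothesis FG : forall x,
  f ^+ m *: (A *m eval_forms F (B *m x)) = c *: eval_forms G x.

Let AB : A *m B = f%:M. Proof. exact: mul_lslice_rslice. Qed.
Let BA : B *m A = f%:M. Proof. exact: mul_rslice_lslice. Qed.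
Let scaleE (a : T) (u : 'cV[T]_N.+1) s z : (a *: u) s z = a * u s z.
Proof. by rewrite mxE. Qed.

Let GAx x : f ^+ (m + d) *: (A *m eval_forms F x) = c *: eval_forms G (A *m x).
Proof.
rewrite -FG mulmxA BA mul_scalar_mx eval_formsZ -scalemxAr scalerA.
by rewrite exprD.
Qed.

Let FBx x : f ^+ m.+1 *: eval_forms F (B *m x) = c *: (B *m eval_forms G x).
Proof.
rewrite scalemxAr -FG -scalemxAr mulmxA BA mul_scalar_mx scalerA.
by rewrite exprSr.
Qed.

(** Where f is invertible, so is c: evaluate [FBx] at A e_0 and sum with the weights of
    [eliminable1]. *)
Let c_dvd : exists s, c * s = f ^+ (m.+1 + d).
Proof.
have [a a1] := eliminable1 elimF; pose e0 : 'cV[T]_N.+1 := delta_mx 0 0.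
exists (\sum_t a t * (B *m eval_forms G (A *m e0)) t 0).
rewrite -[RHS]mulr1 -a1 !mulr_sumr; apply: eq_bigr => t _.
have /matrixP/(_ t 0) := FBx (A *m e0).
rewrite mulmxA BA mul_scalar_mx eval_formsZ scalerA -exprD !scaleE => e.
by rewrite mulrCA -e mulrCA.
Qed.

Lemma pivot_conj_eqs x y i j' k l s t : exists e, f ^+ e *
  (eval_forms G (lslice p k l *m x) s 0 * eval_forms F (rslice p i j' *m y) t 0
   - p i j' k l ^+ d.-1 * ((lslice p k l *m eval_forms F x) s 0 *
       (rslice p i j' *m eval_forms G y) t 0)) = 0.
Proof.
have [seg _ _] := pglp.
have [r cr] := c_dvd.
(* After multiplication by f, every slice is a multiple of A or B; the factors a and b satisfy a b =
   f q. *)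
set a := p ord0 j k l; set b := p i j' j ord0; set q := p i j' k l.
have abE : a * b = f * q by rewrite /a /b mulrC seg.
have fA : f *: lslice p k l = a *: A.
  by rewrite pgl_sub_pivot ?mxE //; apply: lslice_sub.
have fB : f *: rslice p i j' = b *: B by exact: rslice_pivot.
have /matrixP/(_ s 0) := GAx x; have /matrixP/(_ t 0) := FBx y.
set Gs := eval_forms G (_ *m x) s 0; set Ft := eval_forms F (_ *m y) t 0.
have eG : f ^+ d * Gs = a ^+ d * eval_forms G (A *m x) s 0.
  by rewrite -!scaleE -!eval_formsZ !scalemxAl fA.
have eF : f ^+ d * Ft = b ^+ d * eval_forms F (B *m y) t 0.
  by rewrite -!scaleE -!eval_formsZ !scalemxAl fB.
set As := (lslice p k l *m _) s 0; set Bt := (rslice p i j' *m _) t 0.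
have eA : f * As = a * (A *m eval_forms F x) s 0.
  by rewrite -!scaleE !scalemxAl fA.
have eB : f * Bt = b * (B *m eval_forms G y) t 0.
  by rewrite -!scaleE !scalemxAl fB.
rewrite !scaleE.
move: (eval_forms G _ s 0) (eval_forms F _ t 0) eG eF => G0 F0 eG eF.
move: ((A *m _) s 0) ((B *m _) t 0) eA eB => A0 B0 eA eB e2 e1.
(* The factor f^(m+1+d) is c r, f^(m+1) serves [FBx], and the two f^d pass from the given slices
   inside G and F to A and B. *)
exists ((m.+1 + d) + m.+1 + d + d)%N.
apply/eqP; rewrite mulrBr subr_eq0; apply/eqP.
have dE : f ^+ d = f * f ^+ d.-1 by rewrite -exprS prednK.
transitivity (f ^+ (m.+1 + d) * f ^+ m.+1 * ((f ^+ d * Gs) * (f ^+ d * Ft))).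
  by rewrite !exprD; ring.
transitivity (r * (c * G0) * (f ^+ m.+1 * F0) * (a ^+ d * b ^+ d)).
  by rewrite eG eF -cr; ring.
have qd : q ^+ d = q * q ^+ d.-1 by rewrite -exprS prednK.
rewrite -e1 e2 -exprMn abE exprMn qd.
transitivity ((c * r) * f ^+ (m + d) * f ^+ d * q ^+ d.-1 * (q * (A0 * B0))).
  by ring.
rewrite cr.
transitivity (f ^+ (m.+1 + d) * f ^+ m.+1 * f ^+ d * (f ^+ d.-1 * q ^+ d.-1) * (q * (A0 * B0))).
  by rewrite (exprD _ m d) dE exprS; ring.
transitivity (f ^+ (m.+1 + d) * f ^+ m.+1 * (f ^+ d.-1 * f ^+ d.-1) * q ^+ d.-1 *
  ((f * As) * (f * Bt))).
  rewrite eA eB dE.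
  transitivity (f ^+ (m.+1 + d) * f ^+ m.+1 * (f ^+ d.-1 * f ^+ d.-1) * q ^+ d.-1 *
    ((f * q) * (A0 * B0))); first by ring.
  by rewrite -abE; ring.
by rewrite !exprD !dE; ring.
Qed.

End PivotEqs.

Lemma eliminable_map (N d : nat) (S T : comPzRingType) (h : {rmorphism S -> T})
    (F : forms S N d) : eliminable F -> eliminable (map_forms h F).
Proof.
case=> k [Q QE]; exists k, (fun j => map_forms h (Q j)) => U g w j.
exact: (QE U (g \o h)).
Qed.

Lemma conj_tensor_of_conj (N d : nat) (S : comPzRingType) (p : tensor N S)
    (F G : forms S N d) :
  (0 < d)%N -> pgl_tensor p -> eliminable F -> eliminable G ->
  (forall (T : comPzRingType) (k : {rmorphism S -> T}) (L : 'cV[T]_N.+1 -> Prop),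
     PN_point L -> conj_endo (pgl_sub (map_tensor k p)) (map_forms k F) L
                   = endo (map_forms k G) L) ->
  conj_tensor F G p.
Proof.
move=> d_gt0; elim/nonzero_ring_ind: S p F G => [S S0|S] p F G pglp elimF elimG conjFG.
  move=> T h x y i j k l s t; apply: zero_ring.
  by rewrite -(rmorph1 h) S0 rmorph0.
move=> T h x y i j' k l s t; apply/eqP; rewrite -subr_eq0; apply/eqP.
have pglT := map_pgl_tensor h pglp.
set D := (X in X = 0).
suff : 1 * D = 0 by rewrite mul1r.
apply: (@comaximal_powers _ (fun z => z * D = 0) _ _ _ (pivot_sum1 pglT)).
  split=> [|a b aD bD|a b bD]; first by rewrite mul0r.
    by rewrite mulrDl aD bD addr0.
  by rewrite -mulrA bD mulr0.
move=> j; have [c cE] := conj_pivot_const pglp elimG conjFG j.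
exact: (pivot_conj_eqs pglT (eliminable_map h elimF) d_gt0 (cE T h)).
Qed.

(** * Finiteness *)

Section Degree.
Variables (R : comNzRingType) (m : nat) (B : comPzRingType).
Variable phi : {rmorphism {mpoly R[m]} -> B}.

(** The image of the polynomials of total degree at most k, described by generators so that proofs
    run by induction on sums of terms. *)
Inductive deg_le (k : nat) : B -> Prop :=
| deg_le0 : deg_le k 0
| deg_leD x y : deg_le k x -> deg_le k y -> deg_le k (x + y)
| deg_le_monomial c (u : 'X_{1..m}) : (mdeg u <= k)%N ->
    deg_le k (phi (c%:MP * 'X_[u])).

Lemma deg_leW a b x : (a <= b)%N -> deg_le a x -> deg_le b x.
Proof.
move=> ab; elim=> [|? ? _ + _|c u ua]; [exact: deg_le0|exact: deg_leD|].
by apply: deg_le_monomial; apply: leq_trans ab.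
Qed.

Lemma deg_leM a b x y : deg_le a x -> deg_le b y -> deg_le (a + b) (x * y).
Proof.
move=> xa yb; elim: xa => [|? ? _ + _|c u ua].
- by rewrite mul0r; apply: deg_le0.
- by rewrite mulrDl; apply: deg_leD.
elim: yb => [|? ? _ + _|e v vb].
- by rewrite mulr0; apply: deg_le0.
- by rewrite mulrDr; apply: deg_leD.
rewrite -rmorphM mulrACA -mpolyCM -mpolyXD; apply: deg_le_monomial.
by rewrite mdegD leq_add.
Qed.

Lemma deg_leC k c : deg_le k (phi c%:MP).
Proof. by rewrite -[_%:MP]mulr1 -mpolyX0; apply: deg_le_monomial; rewrite mdeg0. Qed.

Lemma deg_le1 k : deg_le k 1.
Proof. by rewrite -(rmorph1 phi) -mpolyC1; apply: deg_leC. Qed.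

Lemma deg_leV i : deg_le 1 (phi 'X_i).
Proof. by rewrite -['X_i]mul1r -mpolyC1; apply: deg_le_monomial; rewrite mdeg1. Qed.

Lemma deg_leX k x : deg_le 1 x -> deg_le k (x ^+ k).
Proof.
move=> x1; elim: k => [|k IH]; first exact: deg_le1.
by rewrite exprS -add1n; apply: deg_leM.
Qed.

Lemma deg_le_sum (I : finType) k (f : I -> B) :
  (forall i, deg_le k (f i)) -> deg_le k (\sum_i f i).
Proof.
by move=> fk; apply: big_ind => // [|x y]; [apply: deg_le0|apply: deg_leD].
Qed.

Lemma deg_le_eval N d (F : forms R N d) (w : 'cV[B]_N.+1) i :
  (forall j, deg_le 1 (w j 0)) ->
  deg_le d (eval_forms (map_forms (phi \o @mpolyC m R) F) w i 0).
Proof.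
move=> w1; rewrite mxE; apply: deg_le_sum => u.
rewrite -[d in deg_le d _]add0n; apply: deg_leM; first exact: deg_leC.
rewrite -[d in deg_le d _](dmon_expE u).
apply: (big_ind2 (fun x k => deg_le k x)) => [|x k y l|j _].
- exact: deg_le1.
- exact: deg_leM.
- exact: deg_leX.
Qed.

(** By the pigeonhole principle a monomial of degree greater than m e contains some X_i^(e+1), which
    the hypothesis rewrites in smaller degree. So the monomials of degree at most m e span [B]. *)
Lemma finite_of_degree (e : nat) :
  (forall y, exists x, phi x = y) -> (forall i, deg_le e (phi 'X_i ^+ e.+1)) ->
  module_finite (phi \o @mpolyC m R).
Proof.
move=> surj Xe; pose M := (m * e).+1; pose I := 'X_{1..m < M}.
pose W z := exists c : I -> R, z = \sum_u phi (c u)%:MP * phi 'X_[u : 'X_{1..m}].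
have WD x y : W x -> W y -> W (x + y).
  move=> [a ->] [b ->]; exists (fun u => a u + b u); rewrite -big_split.
  by apply: eq_bigr => u _; rewrite mpolyCD rmorphD mulrDl.
have W0 : W 0.
  by exists (fun=> 0); rewrite big1 // => u _; rewrite mpolyC0 rmorph0 mul0r.
have WZ c x : W x -> W (phi c%:MP * x).
  move=> [a ->]; exists (fun u => c * a u); rewrite mulr_sumr.
  by apply: eq_bigr => u _; rewrite mpolyCM rmorphM mulrA.
have Wsmall (u : 'X_{1..m}) : (mdeg u <= m * e)%N -> W (phi 'X_[u]).
  move=> ue; pose u' : I := BMultinom (ue : mdeg u < M)%N.
  exists (fun v => (v == u')%:R); rewrite (bigD1 u') //= eqxx rmorph1 mul1r.
  by rewrite big1 ?addr0 // => v /negPf ->; rewrite mpolyC0 rmorph0 mul0r.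
have WX k : forall u : 'X_{1..m}, (mdeg u <= k)%N -> W (phi 'X_[u]).
  elim: k => [|k IH] u uk; first by apply: Wsmall; apply: leq_trans uk _.
  case: (leqP (mdeg u) (m * e)) => [/Wsmall//|big].
  have [i ui] : exists i, (e < u i)%N.
    apply/existsP; apply: contraLR big; rewrite negb_exists => /forallP ue.
    rewrite -leqNgt mdegE -[m in (m * _)%N]card_ord -sum_nat_const.
    by apply: leq_sum => i _; rewrite leqNgt.
  pose v := (u - U_(i) *+ e.+1)%MM.
  have uv : (u = v + U_(i) *+ e.+1)%MM.
    rewrite submK //; apply/mnm_lepP => j; rewrite mulmnE mnmE.
    by case: eqVneq => [<-|_]; rewrite ?mul1n ?mul0n.
  have uk' : (mdeg v + e.+1 <= k.+1)%N.
    by move: uk; rewrite uv mdegD mdegMn mdeg1 mul1n.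
  rewrite uv mpolyXD rmorphM -mpolyXn rmorphXn.
  elim: (Xe i) => [|x y _ + _|c w we].
  - by rewrite mulr0.
  - by rewrite mulrDr; apply: WD.
  rewrite rmorphM mulrCA -rmorphM -mpolyXD; apply: WZ; apply: IH.
  by rewrite mdegD -ltnS; apply: leq_trans uk'; rewrite addnS ltnS leq_add2l.
have Wall z : W z.
  have [q <-] := surj z; rewrite [q]mpolyE rmorph_sum.
  apply: big_ind => // u _; rewrite -mul_mpolyC rmorphM; apply: WZ.
  exact: (WX (mdeg u)).
exists #|{: I}|, (fun i => phi 'X_[(enum_val i : I)]) => z.
have [c ->] := Wall z; exists (fun i => c (enum_val i)) => /=.
rewrite (reindex (@enum_val I {: I})) //=.
by apply: onW_bij; apply: enum_val_bij.
Qed.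

End Degree.

(** * The representing algebra *)

Section UniversalTensor.
Variables (N d : nat).

Definition conj_defect (T : comPzRingType) (F G : forms T N d) (p : tensor N T)
    (x y : 'cV[T]_N.+1) i j k l s t : T :=
  eval_forms G (lslice p k l *m x) s 0 * eval_forms F (rslice p i j *m y) t 0 -
  p i j k l ^+ d.-1 *
    ((lslice p k l *m eval_forms F x) s 0 * (rslice p i j *m eval_forms G y) t 0).

Lemma conj_defectP (T : comPzRingType) (F G : forms T N d) p x y :
  conj_eqs F G p x y <-> forall i j k l s t, conj_defect F G p x y i j k l s t = 0.
Proof.
split=> e i j k l s t; apply/eqP; first by rewrite subr_eq0; apply/eqP/e.
by rewrite -subr_eq0; apply/eqP/e.
Qed.

Lemma map_conj_defect (S T : comPzRingType) (h : {rmorphism S -> T})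
    (F G : forms S N d) p x y i j k l s t :
  h (conj_defect F G p x y i j k l s t) =
  conj_defect (map_forms h F) (map_forms h G) (map_tensor h p)
    (map_mx h x) (map_mx h y) i j k l s t.
Proof.
have hE (u : 'cV[S]_N.+1) a : h (u a 0) = (map_mx h u) a 0 by rewrite mxE.
rewrite rmorphB !rmorphM rmorphXn !hE !map_mxM !map_eval_forms !map_mxM.
by rewrite !map_lslice !map_rslice.
Qed.

Definition nvars := #|{: 'I_N.+1 * 'I_N.+1 * 'I_N.+1 * 'I_N.+1}|.

Definition univ_tensor (R : comNzRingType) : tensor N {mpoly R[nvars]} :=
  fun i j k l => 'X_(enum_rank (i, j, k, l)).

Variables (R : comNzRingType) (F G : forms R N d).
Local Notation A0 := {mpoly R[nvars]}.
Local Notation A1 := {mpoly A0[N.+1 + N.+1]}.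

(** The equations at generic x and y, whose coordinates are the two blocks of new variables. The
    coefficients in [A0] are the equations that conjugation imposes on the tensor. *)
Definition univ_defect i j k l s t : A1 :=
  let C := (@mpolyC (N.+1 + N.+1) A0) \o (@mpolyC nvars R) in
  conj_defect (map_forms C F) (map_forms C G)
    (map_tensor (@mpolyC _ A0) (univ_tensor R))
    (\col_a 'X_(lshift N.+1 a)) (\col_a 'X_(rshift N.+1 a)) i j k l s t.

Lemma map_univ_defect (S T : comPzRingType) (phi : {rmorphism A0 -> S})
    (h : {rmorphism S -> T}) (ev : {rmorphism A1 -> T}) (x y : 'cV[T]_N.+1) i j k l s t :
  (forall z, ev z%:MP = h (phi z)) ->
  (forall a, ev 'X_(lshift N.+1 a) = x a 0) ->
  (forall a, ev 'X_(rshift N.+1 a) = y a 0) ->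
  ev (univ_defect i j k l s t) =
  conj_defect (map_forms h (map_forms (phi \o @mpolyC _ R) F))
    (map_forms h (map_forms (phi \o @mpolyC _ R) G))
    (map_tensor h (map_tensor phi (univ_tensor R))) x y i j k l s t.
Proof.
move=> evC evx evy; rewrite /univ_defect map_conj_defect; congr conj_defect.
- apply: boolp.funext => a; apply: boolp.funext => b.
  by rewrite /map_forms /= evC.
- apply: boolp.funext => a; apply: boolp.funext => b.
  by rewrite /map_forms /= evC.
- do 4!apply: boolp.funext => ?.
  by rewrite /map_tensor evC.
- by apply/matrixP => a b; rewrite !mxE evx (ord1 b).
- by apply/matrixP => a b; rewrite !mxE evy (ord1 b).
Qed.

Definition conj_relations (I : A0 -> Prop) : Prop :=
  let p := univ_tensor R in
  [/\ is_ideal I,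
      forall i j k l i' j' k' l',
        I (p i j k l * p i' j' k' l' - p i' j' k l * p i j k' l'),
      forall i l, I (\sum_j p i j j l - (i == l)%:R),
      forall k j, I (\sum_i p i j k i - (k == j)%:R)
    & forall i j k l s t u, I ((univ_defect i j k l s t)@_u)].

(** From relations to equations, the generic x and y are specialized to the given vectors.
    Conversely, x and y are taken to be vectors of independent variables over [S], and coefficients
    are compared. *)
Lemma conj_relations_ker (S : comPzRingType) (phi : {rmorphism A0 -> S}) :
  conj_relations (fun z => phi z = 0) <->
  pgl_tensor (map_tensor phi (univ_tensor R)) /\
  conj_tensor (map_forms (phi \o @mpolyC _ R) F) (map_forms (phi \o @mpolyC _ R) G)
    (map_tensor phi (univ_tensor R)).
Proof.
have subE x y : phi (x - y) = 0 <-> phi x = phi y.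
  rewrite rmorphB; split=> [/eqP|->]; last by rewrite subrr.
  by rewrite subr_eq0 => /eqP.
split=> [[_ seg c1 c2 def]|[[seg c1 c2] conj]].
  split; first split=> *.
  - by rewrite /map_tensor -!rmorphM; apply/subE.
  - by rewrite /map_tensor -rmorph_sum -(rmorph_nat phi); apply/subE.
  - by rewrite /map_tensor -rmorph_sum -(rmorph_nat phi); apply/subE.
  move=> T h x y; apply/conj_defectP => i j k l s t.
  have [ev [evC evX]] := mpoly_hom_exists (h \o phi)
    (fun a => match split a with inl b => x b 0 | inr b => y b 0 end).
  transitivity (ev (univ_defect i j k l s t)); last first.
    by rewrite mpoly_homE big1 // => u _; rewrite evC /= def rmorph0 mul0r.
  rewrite (@map_univ_defect S T phi h ev x y) // => a; rewrite evX.
    by rewrite (unsplitK (inl _ a)).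
  by rewrite (unsplitK (inr _ a)).
split; first exact: ker_ideal.
- by move=> *; apply/subE; rewrite !rmorphM; apply: seg.
- by move=> i l; apply/subE; rewrite rmorph_sum rmorph_nat; apply: c1.
- by move=> k j; apply/subE; rewrite rmorph_sum rmorph_nat; apply: c2.
move=> i j k l s t u; move: phi {seg c1 c2 subE} conj.
elim/nonzero_ring_ind: S => [S S0|S] phi conj; first exact: zero_ring.
rewrite -(mcoeff_map_mpoly phi) -[RHS](mcoeff0 _ u); congr (_@_u).
pose x : 'cV[{mpoly S[N.+1 + N.+1]}]_N.+1 := \col_a 'X_(lshift N.+1 a).
pose y : 'cV[{mpoly S[N.+1 + N.+1]}]_N.+1 := \col_a 'X_(rshift N.+1 a).
have /conj_defectP/(_ i j k l s t) <- := conj _ (@mpolyC (N.+1 + N.+1) S) x y.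
apply: (@map_univ_defect S {mpoly S[N.+1 + N.+1]} phi (@mpolyC _ S) (map_mpoly phi))
  => [z|a|a] /=.
- by rewrite map_mpolyC.
- by rewrite map_mpolyX mxE.
- by rewrite map_mpolyX mxE.
Qed.

Lemma conj_algebra_exists :
  exists (B : comPzRingType) (pi : {rmorphism A0 -> B}),
    (forall y, exists x, pi x = y) /\
    forall (S : comPzRingType) (phi : {rmorphism A0 -> S}),
      (forall z, pi z = 0 -> phi z = 0) <->
      pgl_tensor (map_tensor phi (univ_tensor R)) /\
      conj_tensor (map_forms (phi \o @mpolyC _ R) F)
        (map_forms (phi \o @mpolyC _ R) G) (map_tensor phi (univ_tensor R)).
Proof.
(* The ideal generated by the relations, as the intersection of all ideals that contain them. *)
pose I z := forall J, conj_relations J -> J z.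
have idI : is_ideal I.
  split=> [J [[]]//|x y Ix Iy J rJ|a x Ix J rJ].
    by case: (rJ) => -[_ JD _] _ _ _ _; apply: JD; [apply: Ix|apply: Iy].
  by case: (rJ) => -[_ _ JM] _ _ _ _; apply: JM; apply: Ix.
have rI : conj_relations I.
  split=> //.
  - by move=> i j k l i' j' k' l' J [_ seg _ _ _]; apply: seg.
  - by move=> i l J [_ _ c1 _ _]; apply: c1.
  - by move=> k j J [_ _ _ c2 _]; apply: c2.
  - by move=> i j k l s t u J [_ _ _ _ def]; apply: def.
have [B [pi [surj kerpi]]] := quotient_ring idI.
exists B, pi; split=> // S phi; rewrite -conj_relations_ker; split=> [kphi|rphi z].
  case: rI => _ r1 r2 r3 r4; split; first exact: ker_ideal.
  - by move=> *; apply/kphi/kerpi; apply: r1.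
  - by move=> *; apply/kphi/kerpi; apply: r2.
  - by move=> *; apply/kphi/kerpi; apply: r3.
  - by move=> *; apply/kphi/kerpi; apply: r4.
by move=> /kerpi Iz; apply: (Iz _ rphi).
Qed.

End UniversalTensor.

Lemma conj_tensor_integral (N d : nat) (R : comNzRingType) (F G : forms R N d)
    (B : comPzRingType) (phi : {rmorphism {mpoly R[nvars N]} -> B}) :
  (1 < d)%N -> unit_resultant F -> unit_resultant G ->
  conj_tensor (map_forms (phi \o @mpolyC _ R) F) (map_forms (phi \o @mpolyC _ R) G)
    (map_tensor phi (univ_tensor R)) ->
  exists e, forall i, deg_le phi e (phi 'X_i ^+ e.+1).
Proof.
move=> d1 /unit_resultantP[kF [QF QFE]] /unit_resultantP[kG [QG QGE]] conj.
pose psi : {rmorphism R -> B} := phi \o @mpolyC (nvars N) R.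
(* The cofactors of the two eliminations contribute kG and kF, the power of p in [conj_eqs]
   contributes d - 1, and the two linear expressions 1 each. This is less than the exponent kG + kF
   + 2d because d + 1 < 2d. *)
pose e := ((kG + kF) + (d.-1 + (1 + 1)))%N.
have eE : (e < kG + d + (kF + d))%N by rewrite /e; lia.
exists (kG + d + (kF + d)).-1%N => i.
rewrite prednK ?(leq_trans _ eE) //; apply: (@deg_leW _ _ _ _ e).
  by rewrite -ltnS prednK ?(leq_trans _ eE).
rewrite -[i]enum_valK; case: (enum_val i) => [[[a b] k] l].
set p := map_tensor phi (univ_tensor R).
have p1 a' b' k' l' : deg_le phi 1 (p a' b' k' l') by apply: deg_leV.
rewrite -[phi _]/(p a b k l) exprD.
(* With basis vectors for x and y, row a of [lslice p k l *m x] and row k of [rslice p a b *m y] are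
   both p_abkl, while F(x) and G(y) have coordinates coming from R, hence degree 0. *)
pose x : 'cV[B]_N.+1 := delta_mx b 0; pose y : 'cV[B]_N.+1 := delta_mx l 0.
have lx s : (lslice p k l *m x) s 0 = p s b k l by rewrite -colE !mxE.
have ry t : (rslice p a b *m y) t 0 = p a b t l by rewrite -colE !mxE.
have := QGE B psi (lslice p k l *m x) a; have := QFE B psi (rslice p a b *m y) k.
rewrite lx ry => -> ->; rewrite mulr_suml; apply: deg_le_sum => s.
rewrite mulr_sumr; apply: deg_le_sum => t; rewrite mulrACA.
have conjxy : conj_eqs (map_forms psi F) (map_forms psi G) p x y.
  exact: (conj B idfun).
rewrite conjxy.
have Fx u : deg_le phi 0 (eval_forms (map_forms psi F) x u 0).
  rewrite (_ : x = map_mx psi (delta_mx b 0)) -?map_eval_formsE ?map_delta_mx //.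
  exact: deg_leC.
have Gy u : deg_le phi 0 (eval_forms (map_forms psi G) y u 0).
  rewrite (_ : y = map_mx psi (delta_mx l 0)) -?map_eval_formsE ?map_delta_mx //.
  exact: deg_leC.
apply: deg_leM; apply: deg_leM.
- by apply: deg_le_eval => u; rewrite lx.
- by apply: deg_le_eval => u; rewrite ry.
- exact: deg_leX.
by apply: deg_leM; rewrite mxE; apply: deg_le_sum => u; rewrite mxE;
  apply: (@deg_leM _ _ _ _ 1 0).
Qed.

Lemma PN_point_closed (N : nat) (T : comPzRingType) (L : 'cV[T]_N.+1 -> Prop) :
  PN_point L -> [/\ L 0, forall v w, L v -> L w -> L (v + w)
    & forall a v, L v -> L (a *: v)].
Proof.
case=> P [_ LP _]; split=> [|v w /LP Lv /LP Lw|a v /LP Lv]; apply/LP.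
- by rewrite linear0 mul0mx.
- by rewrite linearD mulmxDl /= Lv Lw.
- by rewrite linearZ -scalemxAl /= Lv.
Qed.

(** * The zero ring *)

Lemma zero_ring_mx (S : comPzRingType) (a b : nat) (X Y : 'M[S]_(a, b)) :
  (1 : S) = 0 -> X = Y.
Proof. by move=> S0; apply/matrixP => i j; apply: zero_ring. Qed.

Lemma zero_ring_span (S : comPzRingType) (a b : nat) (A : 'M[S]_(a, b) -> Prop) X :
  (1 : S) = 0 -> span A X.
Proof. by move=> S0; rewrite (zero_ring_mx X 0 S0); apply: span0. Qed.

Section ZeroRing.
Variables (R : comPzRingType) (N d : nat) (F G : forms R N d).
Hypothesis R0 : (1 : R) = 0.

Let alg0 (S : comPzRingType) (psi : {rmorphism R -> S}) : (1 : S) = 0.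
Proof. by rewrite -(rmorph1 psi) R0 rmorph0. Qed.

Let PGL0 (S : comPzRingType) (psi : {rmorphism R -> S}) (al : 'M[S]_N.+1 -> Prop) :
  PGL_point al <-> forall X, al X.
Proof.
have S0 := alg0 psi; split=> [[[P [_ alP _]] _] X|alT].
  by apply/alP; apply: zero_ring_mx.
have nofield (K : fieldType) (h : {rmorphism S -> K}) : False.
  by have /eqP := rmorph1 h; rewrite S0 rmorph0 eq_sym oner_eq0.
split; last by move=> K h; case: (nofield K h).
exists 0; split=> [|X|K h]; [exact: zero_ring_mx| |by case: (nofield K h)].
by split=> // _; apply: zero_ring_mx.
Qed.

(** Every algebra over the zero ring is zero and has exactly one point of PGL, the full submodule,
    so Spec R itself represents the functor. *)
Lemma zero_ring_represents :
  let u : 'M[R]_N.+1 -> Prop := fun=> True in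
  [/\ module_finite (idfun : {rmorphism R -> R}),
      closed_immersion (idfun : {rmorphism R -> R}) u
    & represents_Conj (idfun : {rmorphism R -> R}) u F G].
Proof.
have over (S : comPzRingType) (psi : {rmorphism R -> S}) al : (forall X, al X) ->
    point_over (N := N) idfun (fun=> True) psi al psi.
  by move=> alT; split=> // X; split=> // _; apply: zero_ring_span; apply: alg0.
split.
- by exists 0%N, (fun=> 0) => x; exists (fun=> 0); apply: zero_ring.
- split; first by apply/(PGL0 idfun).
  move=> S psi al _; exists (fun=> True) => // T k; split=> _; last first.
    by move=> x _; apply: zero_ring; apply: (alg0 (k \o psi)).
  exists (k \o psi); split=> [|h' _ x].
    by apply: over => X; apply: zero_ring_span; apply: (alg0 (k \o psi)).
  by apply: zero_ring; apply: (alg0 (k \o psi)).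
move=> S psi; split=> [h _|h h' _ _ _ x|al [/(PGL0 psi) alT _]].
- split; first by apply/(PGL0 psi) => X; apply: zero_ring_span; apply: alg0.
  move=> T k L _ X.
  by split=> _; apply: zero_ring_span; apply: (alg0 (k \o psi)).
- by apply: zero_ring; apply: (alg0 psi).
- by exists psi; apply: over.
Qed.

End ZeroRing.

(** * Representability over nonzero rings *)

Section Nonzero.
Variables (R : comNzRingType) (N d : nat) (F G : forms R N d).
Hypotheses (d_gt1 : (1 < d)%N) (resF : unit_resultant F) (resG : unit_resultant G).

Lemma tensor_hom_exists (S : comPzRingType) (psi : {rmorphism R -> S})
    (p : tensor N S) :
  exists phi : {rmorphism {mpoly R[nvars N]} -> S},
    (phi \o @mpolyC _ R : R -> S) = psi /\ map_tensor phi (univ_tensor R) = p.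
Proof.
have [phi [phiC phiX]] := mpoly_hom_exists psi (fun i : 'I_(nvars N) =>
  let: (a, b, c, e) := enum_val i in p a b c e).
exists phi; split; first by apply: boolp.funext => c; apply: phiC.
do 4!apply: boolp.funext => ?.
by rewrite /map_tensor phiX enum_rankK.
Qed.

Lemma eq_tensor_hom (S : comPzRingType) (f g : {rmorphism {mpoly R[nvars N]} -> S}) :
  (forall c, f c%:MP = g c%:MP) ->
  map_tensor f (univ_tensor R) = map_tensor g (univ_tensor R) -> f =1 g.
Proof.
move=> fgC fg; apply: eq_mpoly_hom => // i; rewrite -[i]enum_valK.
case: (enum_val i) => [[[a b] c] e].
exact: (congr1 (fun p : tensor N S => p a b c e) fg).
Qed.

Lemma Conj_pgl_sub (S : comPzRingType) (psi : {rmorphism R -> S}) (p : tensor N S) :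
  pgl_tensor p ->
  Conj psi F G (pgl_sub p) <-> conj_tensor (map_forms psi F) (map_forms psi G) p.
Proof.
move=> pglp; split=> [[_ conj]|conj].
  apply: conj_tensor_of_conj => //; [exact: ltnW| | |].
  - exact: unit_resultant_eliminable.
  - exact: unit_resultant_eliminable.
  move=> T k L PL; rewrite -base_change_pgl_sub //.
  by apply: same_subE; apply: conj.
split; first exact: pgl_sub_PGL_point.
move=> T k L PL; rewrite base_change_pgl_sub //.
have [L0 LD LZ] := PN_point_closed PL.
rewrite (@conj_endo_pgl_sub _ _ _ _ _ _ (map_forms (k \o psi) G)) //.
- exact: map_pgl_tensor.
- exact: unit_resultant_eliminable.
- exact: unit_resultant_eliminable.
- exact: conj.
Qed.

Lemma nonzero_ring_represents :
  exists (B : comPzRingType) (iota : {rmorphism R -> B})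
         (u : 'M[B]_N.+1 -> Prop),
    [/\ module_finite iota, closed_immersion iota u
      & represents_Conj iota u F G].
Proof.
have [B [pi [surj Bker]]] := conj_algebra_exists F G.
have [pglu conju] := (Bker B pi).1 (fun z e => e).
pose iota : {rmorphism R -> B} := pi \o @mpolyC (nvars N) R.
pose pu := map_tensor pi (univ_tensor R); pose u := pgl_sub pu.
have bcu (S : comPzRingType) (h : {rmorphism B -> S}) :
    base_change h u = pgl_sub (map_tensor (h \o pi) (univ_tensor R)).
  exact: base_change_pgl_sub.
have pglh (S : comPzRingType) (h : {rmorphism B -> S}) :
    pgl_tensor (map_tensor (h \o pi) (univ_tensor R)).
  exact: (map_pgl_tensor h pglu).
have eq_tensor (S : comPzRingType) (p q : tensor N S) :
    pgl_tensor p -> pgl_tensor q -> pgl_sub p = pgl_sub q -> p = q.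
  by move=> pp pq e; do 4!apply: boolp.funext => ?; apply: pgl_sub_inj.
have extB (S : comPzRingType) (h h' : {rmorphism B -> S}) :
    h \o pi =1 h' \o pi -> h =1 h'.
  by move=> e y; have [z <-] := surj y; apply: e.
(* A tensor over [S] is the same as an R-algebra morphism [phi] on the polynomial ring, so a point
   of Spec B over its class is a factorization of [phi] through [pi]. *)
have homB (S : comPzRingType) (psi : {rmorphism R -> S}) (p : tensor N S)
    (phi : {rmorphism {mpoly R[nvars N]} -> S}) (h : {rmorphism B -> S}) :
    (phi \o @mpolyC _ R : R -> S) = psi -> map_tensor phi (univ_tensor R) = p ->
    pgl_tensor p -> point_over iota u psi (pgl_sub p) h <-> h \o pi =1 phi.
  move=> phiC phip pglp; split=> [[hiota hu]|hphi].
    apply: eq_tensor_hom => [c|].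
      by rewrite -[LHS]/(h (iota c)) hiota -phiC.
    rewrite phip; apply: eq_tensor => //; first exact: pglh.
    by transitivity (base_change h u); [rewrite bcu|apply: same_subE].
  split=> [c|]; first by rewrite -phiC; apply: hphi.
  rewrite bcu; suff -> : map_tensor (h \o pi) (univ_tensor R) = p by [].
  by rewrite -phip; do 4!apply: boolp.funext => ?; apply: hphi.
exists B, iota, u; split.
- have [e eE] := conj_tensor_integral d_gt1 resF resG conju.
  exact: finite_of_degree surj eE.
- split; first exact: pgl_sub_PGL_point.
  move=> S psi al /PGL_point_tensor[p pglp ->].
  have [phi [phiC phip]] := tensor_hom_exists psi p.
  (* The ideal generated by phi(ker pi): [k] kills it exactly when [k \o phi] factors through
     [pi]. *)
  exists (fun s => forall I, is_ideal I -> (forall z, pi z = 0 -> I (phi z)) -> I s).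
    split=> [I [I0 _ _]//|x y Ix Iy I idI Iphi|a x Ix I idI Iphi].
      by case: (idI) => _ ID _; apply: ID; [apply: Ix|apply: Iy].
    by case: (idI) => _ _ IM; apply: IM; apply: Ix.
  move=> T k; rewrite base_change_pgl_sub //.
  have pglk := map_pgl_tensor k pglp.
  have kphiC : ((k \o phi) \o @mpolyC _ R : R -> T) = k \o psi by rewrite -phiC.
  have kphip : map_tensor (k \o phi) (univ_tensor R) = map_tensor k p.
    by rewrite -phip.
  have hP h := homB T (k \o psi) (map_tensor k p) (k \o phi) h kphiC kphip pglk.
  split=> [kJ|[h [/hP hphi _]] x Jx].
    have [|h hE] := @rmorphism_factor _ _ _ pi (k \o phi) surj.
      by move=> z z0; apply: kJ => I _; apply.
    exists h; split=> [|h' /hP h'E]; first exact/hP.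
    by apply: extB => z; rewrite h'E; apply: hE.
  apply: (Jx (fun x => k x = 0)); first exact: ker_ideal.
  by move=> z z0; rewrite -[LHS]hphi /= z0 rmorph0.
move=> S psi; split=> [h hiota|h h' hiota h'iota hh'|al].
- have hC : ((h \o pi) \o @mpolyC _ R : R -> S) = psi.
    by apply: boolp.funext => c; apply: hiota.
  rewrite bcu; apply/Conj_pgl_sub; first exact: pglh.
  have [|_] := (Bker S (h \o pi)).1 _; first by move=> z /= ->; rewrite rmorph0.
  by rewrite hC.
- apply: extB; apply: eq_tensor_hom => [c|].
    by rewrite -[LHS]/(h (iota c)) -[RHS]/(h' (iota c)) hiota h'iota.
  apply: eq_tensor; [exact: pglh|exact: pglh|].
  transitivity (base_change h u); first by rewrite bcu.
  by transitivity (base_change h' u); [apply: same_subE|rewrite bcu].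
case=> /PGL_point_tensor[p pglp ->] conj.
have {}conj : Conj psi F G (pgl_sub p).
  by split=> //; apply: pgl_sub_PGL_point.
have [phi [phiC phip]] := tensor_hom_exists psi p.
have [|h hE] := @rmorphism_factor _ _ _ pi phi surj.
  by apply/Bker; rewrite phip phiC; split=> //; apply/Conj_pgl_sub.
by exists h; apply/(homB _ _ _ phi).
Qed.

End Nonzero.

Theorem mainTheorem7 (R : comPzRingType) (hR : noetherian R) (N d : nat)
    (hd : (2 <= d)%N) (F G : forms R N d)
    (hF : unit_resultant F) (hG : unit_resultant G) :
  exists (B : comPzRingType) (iota : {rmorphism R -> B})
         (u : 'M[B]_N.+1 -> Prop),
    [/\ module_finite iota, closed_immersion iota u
      & represents_Conj iota u F G].
Proof.
elim/nonzero_ring_ind: R F G hF hG {hR} => [R R0|R] F G hF hG.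
  by exists R, idfun, (fun=> True); apply: zero_ring_represents.
exact: nonzero_ring_represents.
Qed.
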